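(* Endow $\bar X$ with the QED metric $\bar d_2$. A generic point $\bar x\in\bar X$ has a neighborhood $U$ such that sets contained in $U$ have unique means, centroids and circumcenters. The same holds for the QED metric on unordered tree-shapes: generic points of $(\bar{\bar X},\bar{\bar d}_2)$ have neighborhoods within which means, circumcenters and centroids exist and are unique. For the TED metric (on $\bar X$ and $\bar{\bar X}$), means, centroids and circumcenters are not unique. The same results hold in the restricted tree-spaces $\bar Z$ and (for $Z$ saturated with respect to the reordering group $G$) $\bar{\bar Z}$, with the corresponding metrics induced by $d_2$ (QED) and $d_1$ (TED).
   Context: Setting. Fix integers $d,n\ge 1$ (in the paper $d=2$ or $3$) and a finite rooted ordered (planar) binary tree $\mathscr T=(V,E,r)$ with $E\neq\emptyset$: every non-leaf vertex has exactly two children, and the children of each vertex are totally ordered. The tree pre-shape space is the vector space $X=\prod_{e\in E}(\mathbb R^d)^n$, with elements $x=(x_e)_{e\in E}$. On $X$ consider the metrics $d_1(x,y)=\sum_{e\in E}\|x_e-y_e\|$ and $d_2(x,y)=\sqrt{\sum_{e\in E}\|x_e-y_e\|^2}$, where $\|\cdot\|$ is the Euclidean norm on $(\mathbb R^d)^n$. Equivalence. For $x\in X$, the collapsed tree of $x$ is the rooted ordered tree with edge attributes obtained from $\mathscr T$ by contracting every edge $e$ with $x_e=0$ (when an edge from $u$ down to $v$ is contracted, the children of $v$ are inserted, in order, at the position of $v$ among the children of $u$) and keeping the attribute $x_e$ on each remaining edge. Put $x\sim y$ iff the collapsed trees of $x$ and $y$ are isomorphic as rooted ordered trees with edge attributes.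 The space of ordered tree-like shapes is $\bar X=X/\sim$; write $\bar x$ for the class of $x$. Quotient pseudometric. If $(Y,\rho)$ is a metric space with an equivalence relation $\approx$, the quotient pseudometric on $Y/\approx$ is $$\bar\rho([x],[y])=\inf\Big\{\sum_{i=1}^k \rho(x_i,y_i)\ :\ k\ge 1,\ x_1\in[x],\ y_i\approx x_{i+1}\ (1\le i<k),\ y_k\in[y]\Big\}.$$ The TED metric $\bar d_1$ and the QED metric $\bar d_2$ on $\bar X$ are the quotient metrics induced by $d_1$ and $d_2$. Unordered tree-shapes. $G$ is the finite group of reorderings of $\mathscr T$, i.e. of automorphisms of $\mathscr T$ as a rooted tree when the sibling orders are forgotten; it acts on $X$ by permuting the edge coordinates. $\bar{\bar X}=\bar X/G$ is the quotient of $\bar X$ by the equivalence relation generated by $\bar x\approx\overline{g x}$ for $x\in X$, $g\in G$. The TED and QED metrics $\bar{\bar d}_1,\bar{\bar d}_2$ on $\bar{\bar X}$ are the quotient metrics induced by $\bar d_1,\bar d_2$. Restricted spaces. A subset $E'\subset E$ determines a combinatorial ordered rooted tree (its topology) by contracting in $\mathscr T$ all edges outside $E'$. Let $\mathcal E$ be a nonempty family of subsets of $E$ such that if $E'\in\mathcal E$ and $E''\subset E$ determines the same ordered topology as $E'$, then $E''\in\mathcal E$. The restricted pre-shape space is $Z=\bigcup_{E'\in\mathcal E}\{x\in X: x_e=0\text{ for }e\notin E'\}$, with the metric $d_Z$ induced by $d\in\{d_1,d_2\}$ (the length metric: infimum of $d$-lengths of paths in $Z$); $\bar Z=Z/\sim_Z\subset\bar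 X$ with $\sim_Z$ the restriction of $\sim$, with the quotient metric induced by $d_Z$. $Z$ is saturated with respect to $G$ if for every topology appearing in $\mathcal E$, every subset of $E$ whose topology is a reordering of siblings of that topology also lies in $\mathcal E$. Then $\bar{\bar Z}=\bar Z/G$ is the image of $\bar Z$ in $\bar{\bar X}$ (quotient of $\bar Z$ by the restriction of $\approx$), with the quotient metric induced from $\bar Z$. Generic. ''A generic point has property $P$'' means that $P$ holds on an open dense subset of the space. Averages in a metric space $(Y,\rho)$. A mean of a nonempty finite set $\{x_1,\dots,x_s\}$ is a minimizer over $x\in Y$ of $\sum_i\rho(x,x_i)^2$. A circumcenter of a nonempty bounded set is the center of a smallest closed ball containing it. The centroid of a finite set $S$ (in a region where points are joined by unique geodesics) is defined recursively: for $|S|=2$ it is the midpoint of the geodesic joining the two points; for $|S|=m>2$ let $c^1(S)$ be the family of the $m$ centroids of the $(m-1)$-element subfamilies of $S$ and $c^k(S)=c^1(c^{k-1}(S))$; if the elements of $c^k(S)$ converge to one point $c$ as $k\to\infty$, then $c$ is the centroid of $S$. Thus ''sets'' means finite sets for means and centroids, and bounded sets for circumcenters. For the TED metric, centroids of two-point sets are understood as midpoints of geodesics joining the two points, and ''not unique'' means that uniqueness fails for some two-point datasets.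
   Formalization: For the TED metric on the restricted spaces, non-uniqueness is stated only when some E' in the family has at least two edges; otherwise the restricted space is a point or Euclidean, and averages are unique. *)

(* Defs.v *)
From HB Require Import structures.
From Stdlib Require Export Relation_Operators.
From mathcomp Require Export all_boot all_order all_algebra all_fingroup.
From mathcomp Require Export all_classical all_reals all_analysis.

Set Implicit Arguments.
Unset Strict Implicit.
Unset Printing Implicit Defensive.

Import Order.TTheory GRing.Theory Num.Theory.
Import numFieldNormedType.Exports.

Local Open Scope quotient_scope.
Local Open Scope classical_set_scope.
Local Open Scope ring_scope.

(** * Metric notions

A space is given by a type [T], a subset [D : set T] of points and a distance
function [rho], only used on [D].  [rho] is a plain function rather than a
canonical structure because the same carrier bears several metrics, and because
separation of points by a quotient pseudometric is a theorem. *)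

Definition mball {R : realType} {T : Type} (D : set T) (rho : T -> T -> R)
  (a : T) (r : R) : set T := [set b | D b /\ rho a b < r].

Definition mnbhs {R : realType} {T : Type} (D : set T) (rho : T -> T -> R)
    (a : T) (U : set T) : Prop :=
  U `<=` D /\ exists2 r : R, 0 < r & mball D rho a r `<=` U.

Definition mopen {R : realType} {T : Type} (D : set T) (rho : T -> T -> R)
    (V : set T) : Prop :=
  V `<=` D /\ forall a, V a -> mnbhs D rho a V.

Definition mdense {R : realType} {T : Type} (D : set T) (rho : T -> T -> R)
    (V : set T) : Prop :=
  forall a, D a -> forall r : R, 0 < r -> exists2 b, V b & mball D rho a r b.

Definition generic {R : realType} {T : Type} (D : set T) (rho : T -> T -> R)
    (P : T -> Prop) : Prop :=
  exists V : set T,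
    [/\ mopen D rho V, mdense D rho V & forall a, V a -> P a].

Definition mbounded {R : realType} {T : Type} (rho : T -> T -> R)
    (S : set T) : Prop :=
  exists M : R, forall a b, S a -> S b -> rho a b <= M.

Definition is_mean {R : realType} {T : choiceType} (D : set T)
    (rho : T -> T -> R) (S : set T) (m : T) : Prop :=
  D m /\ forall y, D y ->
    \sum_(x \in S) rho m x ^+ 2 <= \sum_(x \in S) rho y x ^+ 2.

Definition is_circumcenter {R : realType} {T : Type} (D : set T)
    (rho : T -> T -> R) (S : set T) (c : T) : Prop :=
  D c /\ exists r : R, (forall x, S x -> rho c x <= r) /\
    forall c' r', D c' -> (forall x, S x -> rho c' x <= r') -> r <= r'.

(* Constant-speed parametrization on [0, 1]; values outside [0, 1] are
   irrelevant. *)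
Definition geodesic {R : realType} {T : Type} (D : set T) (rho : T -> T -> R)
    (a b : T) (g : R -> T) : Prop :=
  [/\ g 0 = a, g 1 = b, forall t : R, t \in `[0, 1] -> D (g t)
    & forall s t : R, s \in `[0, 1] -> t \in `[0, 1] ->
        rho (g s) (g t) = `|s - t| * rho a b].

Definition geodesic_midpoint {R : realType} {T : Type} (D : set T)
    (rho : T -> T -> R) (a b c : T) : Prop :=
  exists2 g, geodesic D rho a b g & g 2^-1 = c.

Definition unique_geodesic_midpoint {R : realType} {T : Type} (D : set T)
    (rho : T -> T -> R) (a b c : T) : Prop :=
  exists g, [/\ geodesic D rho a b g,
    forall h, geodesic D rho a b h -> forall t : R, t \in `[0, 1] -> h t = g t
    & g 2^-1 = c].

(* Centroids of families of k + 2 points.  [C j] is the family $c^j(S)$, whose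
   member [C j.+1 i] is the centroid of the subfamily of [C j] omitting the
   index [i]; these subfamilies may have repeated members even if [S] has none. *)
Fixpoint family_centroid {R : realType} {T : Type} (D : set T)
    (rho : T -> T -> R) (k : nat) : ('I_k.+2 -> T) -> T -> Prop :=
  match k return ('I_k.+2 -> T) -> T -> Prop with
  | 0 => fun F c => unique_geodesic_midpoint D rho (F ord0) (F ord_max) c
  | k'.+1 => fun F c => D c /\ exists C : nat -> 'I_k'.+3 -> T,
      [/\ C 0%N = F,
          forall j (i : 'I_k'.+3),
            family_centroid D rho (fun h : 'I_k'.+2 => C j (lift i h)) (C j.+1 i)
        & forall i, rho (C j i) c @[j --> \oo] --> (0 : R)]
  end.

Definition is_centroid {R : realType} {T : Type} (D : set T)
    (rho : T -> T -> R) (S : set T) (c : T) : Prop :=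
  exists k (F : 'I_k.+2 -> T),
    [/\ injective F, S = range F & family_centroid D rho F c].

(* Centroids are defined from two points on. *)
Definition unique_averages_in {R : realType} {T : choiceType} (D : set T)
    (rho : T -> T -> R) (U : set T) : Prop :=
  [/\ forall S : set T, S `<=` U -> finite_set S -> S !=set0 ->
        exists! m, is_mean D rho S m,
      forall S : set T, S `<=` U -> finite_set S ->
        (exists a b, [/\ S a, S b & a <> b]) ->
        exists! c, is_centroid D rho S c
    & forall S : set T, S `<=` U -> mbounded rho S -> S !=set0 ->
        exists! c, is_circumcenter D rho S c].

Definition generically_unique_averages {R : realType} {T : choiceType}
    (D : set T) (rho : T -> T -> R) : Prop :=
  generic D rho (fun a =>
    exists2 U, mnbhs D rho a U & unique_averages_in D rho U).

(* [avg a b m] : [m] is an average of the two-point set {a, b}. *)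
Definition two_point_uniqueness_fails {T : Type} (D : set T)
    (avg : T -> T -> T -> Prop) : Prop :=
  exists a b m m', [/\ D a, D b & a <> b] /\
    [/\ avg a b m, avg a b m' & m <> m'].

Definition averages_not_unique {R : realType} {T : choiceType} (D : set T)
    (rho : T -> T -> R) : Prop :=
  [/\ two_point_uniqueness_fails D (fun a b => is_mean D rho [set a; b]),
      two_point_uniqueness_fails D (geodesic_midpoint D rho)
    & two_point_uniqueness_fails D
        (fun a b => is_circumcenter D rho [set a; b])].

(* Quotient pseudometric on the image of [D] under the projection [p], two
   points being equivalent when they have the same image. *)
Definition quot_dist {R : realType} {T Q : Type} (p : T -> Q) (D : set T)
    (rho : T -> T -> R) (a b : Q) : R :=
  inf [set s | exists k (x y : nat -> T),
    [/\ forall i, (i <= k)%N -> D (x i) /\ D (y i),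
        p (x 0%N) = a, p (y k) = b,
        forall i, (i < k)%N -> p (y i) = p (x i.+1)
      & s = \sum_(i < k.+1) rho (x i) (y i)]].

Definition path_in {R : realType} {T : Type} (D : set T) (rho : T -> T -> R)
    (a b : T) (g : R -> T) : Prop :=
  [/\ g 0 = a, g 1 = b, forall t : R, t \in `[0, 1] -> D (g t)
    & forall t : R, t \in `[0, 1] -> forall e : R, 0 < e ->
        exists2 del : R, 0 < del & forall s : R, s \in `[0, 1] ->
          `|s - t| < del -> rho (g s) (g t) < e].

Definition path_length {R : realType} {T : Type} (rho : T -> T -> R)
    (g : R -> T) : \bar R :=
  ereal_sup [set (let G := g \o nth 1 (0 :: s) in
                  \sum_(0 <= i < size s) rho (G i) (G i.+1))%:E
            | s in itv_partition 0 1].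

(* Only rectifiable paths matter for the infimum. *)
Definition length_dist {R : realType} {T : Type} (D : set T)
    (rho : T -> T -> R) (a b : T) : R :=
  inf [set l : R | exists2 g : R -> T,
    path_in D rho a b g & path_length rho g = l%:E].

(** * Trees and tree-shapes *)

Inductive btree := Leaf | Node of btree & btree.

(* In [Node l r], [inl None] is the edge from the root to the root of [l] and
   [inl (Some e)] is the edge [e] of [l]; similarly for [r] with [inr]. *)
Fixpoint edge (t : btree) : finType :=
  match t with
  | Leaf => void
  | Node l r => (option (edge l) + option (edge r))%type
  end.

(* Vertices are encoded as [option (edge t)]: [None] is the root and [Some e]
   the lower end of [e].  [upper e] is the upper end of [e]. *)
Fixpoint upper (t : btree) : edge t -> option (edge t) :=
  match t return edge t -> option (edge t) with
  | Leaf => fun _ => None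
  | Node l r => fun e =>
      match e with
      | inl None | inr None => None
      | inl (Some e') => Some (inl (upper e'))
      | inr (Some e') => Some (inr (upper e'))
      end
  end.

(* Finite rooted ordered trees with edge attributes in [A]: the root is given by
   the ordered list of its children, each with the attribute of the edge leading
   to it.  Isomorphism of such trees is equality. *)
Inductive otree (A : Type) := ONode of seq (A * otree A).
Arguments ONode {A} _.

(* The children of the root after contraction of the edges with attribute
   [None]. *)
Fixpoint contract_children {A : Type} (t : btree) :
    (edge t -> option A) -> seq (A * otree A) :=
  match t return (edge t -> option A) -> seq (A * otree A) with
  | Leaf => fun _ => [::]
  | Node l r => fun x =>
      let branch o s := if o is Some a then [:: (a, ONode s)] else s in
      branch (x (inl None)) (contract_children (fun e => x (inl (Some e)))) ++
      branch (x (inr None)) (contract_children (fun e => x (inr (Some e))))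
  end.

Definition contract {A : Type} (t : btree) (x : edge t -> option A) : otree A :=
  ONode (contract_children x).

Inductive children_reordering {A : Type} :
    seq (A * otree A) -> seq (A * otree A) -> Prop :=
| Reorder_nil : children_reordering [::] [::]
| Reorder_cons a s s' u u' : children_reordering s s' ->
    children_reordering u u' ->
    children_reordering ((a, ONode s) :: u) ((a, ONode s') :: u')
| Reorder_swap p q u : children_reordering (p :: q :: u) (q :: p :: u)
| Reorder_trans u v w : children_reordering u v -> children_reordering v w ->
    children_reordering u w.

Definition sibling_reordering {A : Type} (t t' : otree A) : Prop :=
  let: ONode s := t in let: ONode s' := t' in children_reordering s s'.

(* An automorphism of the rooted tree is determined by its action on edges (that
   is, on non-root vertices). *)
Definition is_reordering (t : btree) (g : {perm edge t}) : bool :=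
  [forall e, upper (g e) == omap g (upper e)].

Fact reorderings_group_set (t : btree) :
  group_set [set g : {perm edge t} | is_reordering g]%SET.
Proof.
apply/group_setP; split=> [|g h].
  by rewrite inE; apply/forallP => e; rewrite perm1; case: upper => //= e'; rewrite perm1.
rewrite !inE => /forallP gP /forallP hP; apply/forallP => e.
rewrite permM (eqP (hP _)) (eqP (gP _)).
by case: upper => //= e'; rewrite permM.
Qed.

Definition reorderings (t : btree) : {group {perm edge t}} :=
  Group (reorderings_group_set t).

(* An attribute in $(\mathbb R^d)^n$ is the matrix of its n points, as rows. *)
Definition preshape (R : realType) (d n : nat) (t : btree) : choiceType :=
  {ffun edge t -> 'M[R]_(n, d)}.

Definition enorm {R : realType} {d n : nat} (p : 'M[R]_(n, d)) : R :=
  Num.sqrt (\sum_i \sum_j p i j ^+ 2).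

Definition dist1 {R : realType} {d n : nat} {t : btree}
    (x y : preshape R d n t) : R :=
  \sum_e enorm (x e - y e).

Definition dist2 {R : realType} {d n : nat} {t : btree}
    (x y : preshape R d n t) : R :=
  Num.sqrt (\sum_e enorm (x e - y e) ^+ 2).

Definition collapsed {R : realType} {d n : nat} {t : btree}
    (x : preshape R d n t) : otree 'M[R]_(n, d) :=
  contract (fun e => if x e == 0 then None else Some (x e)).

Definition collapse_equiv {R : realType} {d n : nat} {t : btree} :
    rel (preshape R d n t) :=
  fun x y => `[< collapsed x = collapsed y >].

Fact collapse_equiv_is_equiv (R : realType) (d n : nat) (t : btree) :
  equiv_class_of (@collapse_equiv R d n t).
Proof.
split=> [x|x y|y x z]; first exact/asboolP.
  by apply/asboolP/asboolP.
by move=> /asboolP xy /asboolP yz; apply/asboolP; rewrite xy.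
Qed.

Canonical collapse_equiv_rel (R : realType) (d n : nat) (t : btree) :=
  EquivRelPack (collapse_equiv_is_equiv R d n t).

Definition oshape (R : realType) (d n : nat) (t : btree) : choiceType :=
  {eq_quot (collapse_equiv_rel R d n t)}.

Definition oproj {R : realType} {d n : nat} {t : btree}
    (x : preshape R d n t) : oshape R d n t :=
  \pi_{eq_quot (collapse_equiv_rel R d n t)} x.

Definition oshape_dist {R : realType} {d n : nat} {t : btree}
    (rho : preshape R d n t -> preshape R d n t -> R) :
    oshape R d n t -> oshape R d n t -> R :=
  quot_dist oproj setT rho.

Definition reorder_act {R : realType} {d n : nat} {t : btree} (g : {perm edge t})
    (x : preshape R d n t) : preshape R d n t :=
  [ffun e => x (g^-1%g e)].

Definition reordered {R : realType} {d n : nat} {t : btree}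
    (a b : oshape R d n t) : Prop :=
  exists x g, [/\ g \in reorderings t, a = oproj x & b = oproj (reorder_act g x)].

Definition reorder_equiv {R : realType} {d n : nat} {t : btree} :
    rel (oshape R d n t) :=
  fun a b => `[< clos_refl_sym_trans _ reordered a b >].

Fact reorder_equiv_is_equiv (R : realType) (d n : nat) (t : btree) :
  equiv_class_of (@reorder_equiv R d n t).
Proof.
split=> [x|x y|y x z]; first exact/asboolP/rst_refl.
  by apply/asboolP/asboolP; apply: rst_sym.
by move=> /asboolP xy /asboolP yz; apply/asboolP/(rst_trans _ _ _ _ _ xy yz).
Qed.

Canonical reorder_equiv_rel (R : realType) (d n : nat) (t : btree) :=
  EquivRelPack (reorder_equiv_is_equiv R d n t).

Definition ushape (R : realType) (d n : nat) (t : btree) : choiceType :=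
  {eq_quot (reorder_equiv_rel R d n t)}.

Definition uproj {R : realType} {d n : nat} {t : btree}
    (a : oshape R d n t) : ushape R d n t :=
  \pi_{eq_quot (reorder_equiv_rel R d n t)} a.

Definition ushape_dist {R : realType} {d n : nat} {t : btree}
    (rho : preshape R d n t -> preshape R d n t -> R) :
    ushape R d n t -> ushape R d n t -> R :=
  quot_dist uproj setT (oshape_dist rho).

(** * Restricted spaces *)

Definition topology {t : btree} (E : {set edge t}) : otree unit :=
  contract (fun e => if e \in E then Some tt else None).

Definition topology_closed {t : btree} (F : {set {set edge t}}) : Prop :=
  forall E E' : {set edge t},
    E \in F -> topology E' = topology E -> E' \in F.

Definition saturated {t : btree} (F : {set {set edge t}}) : Prop :=
  forall E E' : {set edge t},
    E \in F -> sibling_reordering (topology E) (topology E') -> E' \in F.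

Definition rpreshape (R : realType) (d n : nat) {t : btree}
    (F : {set {set edge t}}) : set (preshape R d n t) :=
  [set x | exists2 E, E \in F & forall e, e \notin E -> x e = 0].
Arguments rpreshape R d n {t} F _.

Definition roshape (R : realType) (d n : nat) {t : btree}
    (F : {set {set edge t}}) : set (oshape R d n t) :=
  oproj @` rpreshape R d n F.
Arguments roshape R d n {t} F _.

Definition roshape_dist {R : realType} {d n : nat} {t : btree}
    (F : {set {set edge t}})
    (rho : preshape R d n t -> preshape R d n t -> R) :
    oshape R d n t -> oshape R d n t -> R :=
  quot_dist oproj (rpreshape R d n F) (length_dist (rpreshape R d n F) rho).

Definition rushape (R : realType) (d n : nat) {t : btree}
    (F : {set {set edge t}}) : set (ushape R d n t) :=
  uproj @` roshape R d n F.
Arguments rushape R d n {t} F _.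

Definition rushape_dist {R : realType} {d n : nat} {t : btree}
    (F : {set {set edge t}})
    (rho : preshape R d n t -> preshape R d n t -> R) :
    ushape R d n t -> ushape R d n t -> R :=
  quot_dist uproj (roshape R d n F) (roshape_dist F rho).

(* Main.v *)
(** A path in the pre-shape space that starts near a pre-shape [x] of full
    support and distinct edge attributes cannot leave the subspace carrying [x]
    before it is long, and every identification met on the way merely permutes
    the edges.  Hence near the image of [x] each quotient is isometric to a ball
    of a vector space with the l2-sum (QED) or l1-sum (TED) of the Euclidean
    norms of the attributes; such points are open and dense.  In the l2 case
    averages of data in a smaller ball can be computed in Euclidean space,
    averages outside the ball being too far away to compete.  In the l1 case
    with at least two edges, the diagonal of a square in the plane of two edges
    has several midpoints.  The unrestricted spaces are the case where all
    subsets of [E] are allowed. *)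

Require Import Defs.
From mathcomp Require Import ring lra.

Set Implicit Arguments.
Unset Strict Implicit.
Unset Printing Implicit Defensive.

Import Order.TTheory GRing.Theory Num.Theory.
Import numFieldNormedType.Exports.

Local Open Scope classical_set_scope.
Local Open Scope ring_scope.

(** * Quotient distances *)

(** A chain in a quotient may pass through points with many representatives and through subspaces of
    other dimensions. It can still be pulled back to one subspace, because every identification
    comes from a permutation of all edges which preserves both norms and which works simultaneously
    for all pre-shapes with the same support. A step leaves the subspace only by killing an edge,
    which costs the norm of its attribute, or by adding one, which is excluded when no
    representative of the starting point lies in a larger allowed subspace. Besides symmetry, the
    arguments use only two bounds on the distance: it dominates a permutation-invariant norm
    everywhere, and is at most that norm on each coordinate subspace. So length metrics never have
    to be computed across subspaces. Ordered and unordered shapes are handled together, the iterated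
    quotient being rewritten first as a single quotient. *)

Section QuotientDistance.

(** An inductive form of the sums in [quot_dist], suited to structural induction. The free jump
    between two steps is hidden in the tail starting at [p y]. *)
Inductive chain {R : realType} {T Q : Type} (p : T -> Q) (D : set T)
    (rho : T -> T -> R) : Q -> Q -> R -> Prop :=
| Chain1 x y : D x -> D y -> chain p D rho (p x) (p y) (rho x y)
| ChainS x y b s : D x -> D y -> chain p D rho (p y) b s ->
    chain p D rho (p x) b (rho x y + s).

Variables (R : realType) (T Q : Type) (p : T -> Q) (D : set T).
Variable rho : T -> T -> R.

Lemma quot_dist_chain (a b : Q) :
  quot_dist p D rho a b = inf [set s | chain p D rho a b s].
Proof.
rewrite /quot_dist; congr inf; apply/seteqP; split=> s /=.
  move=> [k]; elim: k s a b => [|k IH] s a b [x [y [Dxy <- <- jump ->]]].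
    have [] := Dxy 0%N isT => Dx Dy.
    by rewrite big_ord_recl big_ord0 addr0; exact: Chain1.
  rewrite big_ord_recl; have [Dx Dy] := Dxy 0%N isT.
  apply: ChainS => //; rewrite jump //; apply: IH.
  exists (x \o succn), (y \o succn); split=> //= i ik; first exact: Dxy.
  exact: jump.
elim=> {a b s} [x y Dx Dy|x y b s Dx Dy _ [k [x' [y' [Dxy x0 yk jump ->]]]]].
  exists 0%N, (fun=> x), (fun=> y); split=> //.
  by rewrite big_ord_recl big_ord0 addr0.
exists k.+1, (fun i => if i is j.+1 then x' j else x),
  (fun i => if i is j.+1 then y' j else y); split=> //.
- by case=> [|i] //=; rewrite ltnS => /Dxy.
- by case=> [|i] //=; rewrite ltnS => /jump.
- by rewrite [RHS]big_ord_recl.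
Qed.

Lemma chain_mem a b s : chain p D rho a b s -> (p @` D) a /\ (p @` D) b.
Proof.
by elim=> [x y Dx Dy|x y c u Dx Dy _ [_ Dc]]; split=> //.
Qed.

(* Both sides of [quot_dist_comp] are the junk value [inf set0] outside of the
   image of [D]. *)
Lemma quot_dist_out a b : ~ (p @` D) a \/ ~ (p @` D) b ->
  quot_dist p D rho a b = inf set0.
Proof.
move=> nab; rewrite quot_dist_chain; congr inf; apply/seteqP; split=> // s /=.
by move=> /chain_mem[Da Db]; case: nab.
Qed.

Hypothesis rho_ge0 : forall x y, D x -> D y -> 0 <= rho x y.

Lemma chain_ge0 a b s : chain p D rho a b s -> 0 <= s.
Proof.
elim=> [x y Dx Dy|x y c u Dx Dy _ u0]; first exact: rho_ge0.
by rewrite addr_ge0 // rho_ge0.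
Qed.

Lemma quot_dist_le a b s : chain p D rho a b s -> quot_dist p D rho a b <= s.
Proof.
by rewrite quot_dist_chain => abs; apply: ge_inf => //; exists 0 => u /chain_ge0.
Qed.

Lemma quot_dist_lt a b r : (p @` D) a -> (p @` D) b ->
  quot_dist p D rho a b < r -> exists2 s, chain p D rho a b s & s < r.
Proof.
move=> [x Dx <-] [y Dy <-]; rewrite quot_dist_chain => /inf_lt; apply.
by exists (rho x y); exact: Chain1.
Qed.

Lemma quot_dist_ge a b r : (p @` D) a -> (p @` D) b ->
  (forall s, chain p D rho a b s -> r <= s) -> r <= quot_dist p D rho a b.
Proof.
move=> Da Db rs; rewrite leNgt; apply/negP => /(quot_dist_lt Da Db)[s /rs].
by rewrite leNgt => /negP.
Qed.

Lemma quot_dist_ge0 a b : (p @` D) a -> (p @` D) b -> 0 <= quot_dist p D rho a b.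
Proof. by move=> Da Db; apply: quot_dist_ge => // s /chain_ge0. Qed.

Lemma chain_cat a b c s u :
  chain p D rho a b s -> chain p D rho b c u -> chain p D rho a c (s + u).
Proof.
elim=> [x y Dx Dy|x y e v Dx Dy _ IH] cu; first exact: ChainS.
by rewrite -addrA; apply: ChainS => //; exact: IH.
Qed.

Lemma quot_dist_triangle a b c : (p @` D) a -> (p @` D) b -> (p @` D) c ->
  quot_dist p D rho a c <= quot_dist p D rho a b + quot_dist p D rho b c.
Proof.
move=> Da Db Dc; apply/ler_addgt0Pr => e e0.
have e20 : 0 < e / 2 by rewrite divr_gt0.
have [|s abs sab] := @quot_dist_lt a b (quot_dist p D rho a b + e / 2) Da Db.
  by rewrite ltrDl.
have [|u bcu ubc] := @quot_dist_lt b c (quot_dist p D rho b c + e / 2) Db Dc.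
  by rewrite ltrDl.
by have := quot_dist_le (chain_cat abs bcu); lra.
Qed.

Lemma quot_dist_proj x y : D x -> D y ->
  quot_dist p D rho (p x) (p y) <= rho x y.
Proof. by move=> Dx Dy; exact/quot_dist_le/Chain1. Qed.

Hypothesis rhoC : forall x y, D x -> D y -> rho x y = rho y x.

Lemma chain_rev a b s : chain p D rho a b s -> chain p D rho b a s.
Proof.
elim=> [x y Dx Dy|x y e v Dx Dy _ IH]; rewrite rhoC //; first exact: Chain1.
by rewrite addrC; apply: chain_cat IH _; exact: Chain1.
Qed.

Lemma quot_distC a b : quot_dist p D rho a b = quot_dist p D rho b a.
Proof.
by rewrite !quot_dist_chain; congr inf; apply/seteqP; split=> s /chain_rev.
Qed.

End QuotientDistance.

(** * Quotients taken in two stages *)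

Section QuotientOfQuotient.

Variables (R : realType) (T Q Q' : Type) (p : T -> Q) (q : Q -> Q').
Variables (D : set T) (rho : T -> T -> R).
Hypothesis rho_ge0 : forall x y, D x -> D y -> 0 <= rho x y.

Lemma chain_comp a b s :
  chain p D rho a b s -> chain (q \o p) D rho (q a) (q b) s.
Proof.
elim=> [x y Dx Dy|x y c u Dx Dy _ IH]; first exact: (@Chain1 _ _ _ (q \o p)).
exact: (@ChainS _ _ _ (q \o p)).
Qed.

(** A chain of the single quotient projects step by step to a chain of the iterated one; conversely,
    each step of an iterated chain is replaced by a nearly optimal chain of the first quotient. *)
Lemma quot_dist_comp :
  quot_dist q (p @` D) (quot_dist p D rho) = quot_dist (q \o p) D rho.
Proof.
apply/funext => a; apply/funext => b.
have [[Da Db]|/not_andP nDab] :=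
    EM (((q \o p) @` D) a /\ ((q \o p) @` D) b); last first.
  by rewrite [RHS]quot_dist_out // [LHS]quot_dist_out // image_comp.
have qd_ge0 x y : (p @` D) x -> (p @` D) y -> 0 <= quot_dist p D rho x y.
  exact: quot_dist_ge0.
have pD x : D x -> (p @` D) (p x) by exists x.
have qpD x : D x -> (q @` (p @` D)) ((q \o p) x).
  by move=> Dx; exists (p x) => //; exact: pD.
have imD c : ((q \o p) @` D) c -> (q @` (p @` D)) c by rewrite image_comp.
apply/eqP; rewrite eq_le; apply/andP; split.
  apply: quot_dist_ge => // s abs.
  elim: abs => {a b Da Db s} [x y Dx Dy|x y c u Dx Dy yc IH].
    apply: le_trans (quot_dist_proj _ _ (pD _ Dx) (pD _ Dy)) _ => //.
    exact: quot_dist_proj.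
  have Dc : (q @` (p @` D)) c.
    by elim: yc => [x' y' _ Dy'|//]; exact: qpD.
  apply: le_trans (quot_dist_triangle qd_ge0 (qpD _ Dx) (qpD _ Dy) Dc) _.
  rewrite lerD //; apply: le_trans (quot_dist_proj _ _ _ _) _ => //; try exact: pD.
  exact: quot_dist_proj.
apply: quot_dist_ge; [exact: imD|exact: imD|] => s abs.
apply/ler_addgt0Pr => e e0.
suff [u abu us] : exists2 u, chain (q \o p) D rho a b u & u < s + e.
  by apply: le_trans (ltW us); exact: quot_dist_le.
elim: abs e e0 => {a b Da Db s} [x y Dx Dy|x y c u Dx Dy yc IH] e e0.
  have [|s xys sxy] :=
    @quot_dist_lt _ _ _ p D rho x y (quot_dist p D rho x y + e) Dx Dy.
    by rewrite ltrDl.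
  by exists s => //; exact: chain_comp.
(* Half of the allowed error goes to the first step, the other half to the tail. *)
have e20 : 0 < e / 2 by rewrite divr_gt0.
have [|s xys sxy] :=
    @quot_dist_lt _ _ _ p D rho x y (quot_dist p D rho x y + e / 2) Dx Dy.
  by rewrite ltrDl.
have [v ycv vu] := IH _ e20.
by exists (s + v); [exact: chain_cat (chain_comp xys) ycv|lra].
Qed.

End QuotientOfQuotient.

(** * Collapsed trees and permutations of edges *)

Section Forests.

(** Forests are read as binary trees (first child, next sibling), which supplies the induction
    hypothesis inside the nested [seq]. *)
Lemma forest_ind (A : Type) (P : seq (A * otree A) -> Prop) :
  P [::] -> (forall a s u, P s -> P u -> P ((a, ONode s) :: u)) ->
  forall s, P s.
Proof.
move=> P0 PS.
have Pt : forall t : otree A, let: ONode s := t in P s.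
  fix IHt 1 => -[s]; elim: s => [//|[a t] u IHu].
  by move: (IHt t); case: t => s Ps; exact: PS.
by move=> s; exact: (Pt (ONode s)).
Qed.

Fixpoint otree_map (A B : Type) (f : A -> B) (t : otree A) : otree B :=
  let: ONode s := t in ONode [seq (f p.1, otree_map f p.2) | p <- s].

Fixpoint otree_labels (A : Type) (t : otree A) : seq A :=
  let: ONode s := t in flatten [seq p.1 :: otree_labels p.2 | p <- s].

Definition forest_map (A B : Type) (f : A -> B) (s : seq (A * otree A)) :=
  [seq (f p.1, otree_map f p.2) | p <- s].

Definition forest_labels (A : Type) (s : seq (A * otree A)) :=
  flatten [seq p.1 :: otree_labels p.2 | p <- s].

Lemma forest_labels_cons (A : Type) (a : A) s u :
  forest_labels ((a, ONode s) :: u) = a :: forest_labels s ++ forest_labels u.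
Proof. by []. Qed.

Lemma forest_map_cons (A B : Type) (f : A -> B) (a : A) s u :
  forest_map f ((a, ONode s) :: u) =
  (f a, ONode (forest_map f s)) :: forest_map f u.
Proof. by []. Qed.

Lemma forest_map_cat (A B : Type) (f : A -> B) s u :
  forest_map f (s ++ u) = forest_map f s ++ forest_map f u.
Proof. exact: map_cat. Qed.

Lemma forest_labels_cat (A : Type) (s u : seq (A * otree A)) :
  forest_labels (s ++ u) = forest_labels s ++ forest_labels u.
Proof. by rewrite /forest_labels map_cat flatten_cat. Qed.

Lemma forest_labels_map (A B : Type) (f : A -> B) s :
  forest_labels (forest_map f s) = map f (forest_labels s).
Proof.
elim/forest_ind: s => // a s u IHs IHu.
by rewrite forest_map_cons !forest_labels_cons /= map_cat IHs IHu.
Qed.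

(** A forest is determined by its shape and its preorder list of labels; the first equation says
    that [s1] and [s2] have the same shape. *)
Lemma eq_forest_map (A B C C' : Type) (f : A -> C) (g : B -> C)
    (f' : A -> C') (g' : B -> C') s1 s2 :
  forest_map f s1 = forest_map g s2 ->
  map f' (forest_labels s1) = map g' (forest_labels s2) ->
  forest_map f' s1 = forest_map g' s2.
Proof.
elim/forest_ind: s1 s2 => [|a s u IHs IHu] [|[b [s']] u'] //.
rewrite !forest_map_cons !forest_labels_cons /= => -[_ fs fu] [fa].
(* Subforests of equal shape have equally many labels, which tells where to cut the concatenated
   lists. *)
have size_s : size (map f' (forest_labels s)) = size (map g' (forest_labels s')).
  by have := congr1 size (congr1 (@forest_labels _) fs);
     rewrite !forest_labels_map !size_map.
rewrite !map_cat => lsu.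
have ls := congr1 (take (size (map f' (forest_labels s)))) lsu.
have lu := congr1 (drop (size (map f' (forest_labels s)))) lsu.
rewrite take_size_cat // size_s take_size_cat // in ls.
rewrite drop_size_cat // size_s drop_size_cat // in lu.
by rewrite fa (IHs _ fs ls) (IHu _ fu lu).
Qed.

Fixpoint dfs_edges (t : btree) : seq (edge t) :=
  match t with
  | Leaf => [::]
  | Node l r =>
      (inl None :: [seq inl (Some e) | e <- dfs_edges l]) ++
      (inr None :: [seq inr (Some e) | e <- dfs_edges r])
  end.

Lemma mem_dfs_edges t e : e \in dfs_edges t.
Proof.
elim: t e => [|l IHl r IHr] [] // [e|]; rewrite mem_cat !inE /=.
- by rewrite map_f.
- by [].
- by rewrite (map_f (fun e => inr (Some e)) (IHr e)) orbT.
- by rewrite orbT.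
Qed.

Lemma uniq_dfs_edges t : uniq (dfs_edges t).
Proof.
elim: t => [//|l IHl r IHr] /=; rewrite cat_uniq /=.
rewrite !map_inj_uniq ?IHl ?IHr; try by move=> ? ? [].
rewrite ?andbT ?mem_cat ?inE /=; apply/and3P; split.
- by apply/norP; split; apply/mapP => -[].
- apply/norP; split; first by apply/mapP => -[].
  by apply/hasPn => _ /mapP[e _ ->]; apply/mapP => -[].
- by apply/mapP => -[].
Qed.

Lemma contract_children_map (A B : Type) (f : A -> B) t (x : edge t -> option A) :
  contract_children (fun e => omap f (x e)) = forest_map f (contract_children x).
Proof.
elim: t x => [//|l IHl r IHr] x /=; rewrite IHl IHr forest_map_cat.
by case: (x (inl None)) => [a|]; case: (x (inr None)) => [b|].
Qed.

(** Contraction splices children into the place of their parent, so the surviving edges keep their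
    preorder. *)
Lemma labels_contract_children (A : Type) t (x : edge t -> option A) :
  forest_labels (contract_children x) = pmap x (dfs_edges t).
Proof.
elim: t x => [//|l IHl r IHr] x.
rewrite [dfs_edges _]/= -cat_cons pmap_cat /= forest_labels_cat.
have pmapE (U V : Type) (h : U -> V) (k : V -> option A) s :
    pmap k (map h s) = pmap (k \o h) s by elim: s => //= u s ->.
rewrite !pmapE; case: (x (inl None)) => [a|]; case: (x (inr None)) => [b|] //=;
by rewrite ?forest_labels_cons /= ?cats0 -?IHl -?IHr.
Qed.

End Forests.

Section Transport.

Variables (R : realType) (d n : nat) (t : btree).
Local Notation pre := {ffun edge t -> 'M[R]_(n, d)}.

Definition supp (x : pre) : {set edge t} := [set e | x e != 0].

Lemma reorder_actE (s : {perm edge t}) (x : pre) e :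
  reorder_act s x (s e) = x e.
Proof. by rewrite ffunE permK. Qed.

Lemma reorder_actM (s u : {perm edge t}) (x : pre) :
  reorder_act u (reorder_act s x) = reorder_act (s * u)%g x.
Proof. by apply/ffunP => e; rewrite !ffunE invMg permM. Qed.

Lemma reorder_act1 (x : pre) : reorder_act 1%g x = x.
Proof. by apply/ffunP => e; rewrite ffunE invg1 perm1. Qed.

Lemma supp_reorder_act (s : {perm edge t}) (x : pre) :
  supp (reorder_act s x) = (s @: supp x)%SET.
Proof.
apply/setP => e; rewrite inE -[e](permKV s) reorder_actE.
by rewrite (mem_imset _ _ (@perm_inj _ s)) inE.
Qed.

(** Each kept edge is its own attribute. This separates the shape, which depends on the support
    alone, from the values of [x], put back by [forest_map]. *)
Definition edge_labels (E : {set edge t}) : seq (edge t * otree (edge t)) :=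
  contract_children (fun e => if e \in E then Some e else None).

Lemma collapsedE (x : pre) :
  collapsed x = ONode (forest_map x (edge_labels (supp x))).
Proof.
rewrite /collapsed /contract -contract_children_map; congr (ONode (contract_children _)).
by apply/funext => e; rewrite inE; case: eqP.
Qed.

Lemma labels_edge_labels E :
  forest_labels (edge_labels E) = [seq e <- dfs_edges t | e \in E].
Proof.
by rewrite labels_contract_children; elim: (dfs_edges t) => //= e s ->; case: ifP.
Qed.

(** Stronger than [p (reorder_act s x) = p x]: the same [s] serves for all pre-shapes with the
    support of [x], so it can follow a chain while the attributes move. *)
Definition transports (Q : Type) (p : pre -> Q) (s : {perm edge t}) (x : pre) :=
  forall x', supp x' = supp x -> p (reorder_act s x') = p x'.

(** The permutation matches the kept edges of [x] and of [y] in preorder. Only the supports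
    determine it, whence [transports]. *)
Lemma collapsed_transport (x y : pre) : collapsed x = collapsed y ->
  exists2 s, y = reorder_act s x & transports collapsed s x.
Proof.
rewrite !collapsedE => -[xy].
pose l (E : {set edge t}) := [seq e <- dfs_edges t | e \in E].
(* Kept edges first, contracted ones after: matching [L (supp x)] with [L (supp y)] by position
   extends the matching of kept edges to a permutation of all edges. *)
pose L E := l E ++ l (~: E)%SET.
have lxy : map x (l (supp x)) = map y (l (supp y)).
  by rewrite /l -!labels_edge_labels -!forest_labels_map xy.
have size_l : size (l (supp x)) = size (l (supp y)).
  by have := congr1 size lxy; rewrite !size_map.
have perm_L E : perm_eq (L E) (dfs_edges t).
  have -> : L E = l E ++ [seq e <- dfs_edges t | predC (mem E) e].
    by congr (_ ++ _); apply: eq_filter => e; rewrite /= inE.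
  by rewrite perm_filterC.
have uniq_L E : uniq (L E) by rewrite (perm_uniq (perm_L E)) uniq_dfs_edges.
have mem_L E e : e \in L E by rewrite (perm_mem (perm_L E)) mem_dfs_edges.
have size_L E : size (L E) = size (dfs_edges t) by rewrite (perm_size (perm_L E)).
have idx E e E' : (index e (L E) < size (L E'))%N.
  by rewrite size_L -(size_L E) index_mem.
pose f e := nth e (L (supp y)) (index e (L (supp x))).
have f_inj : injective f.
  move=> e e'; rewrite /f (set_nth_default e') // => /eqP.
  by rewrite nth_uniq // => /eqP ee'; rewrite -(nth_index e (mem_L (supp x) e)) ee'
    (set_nth_default e') ?nth_index.
pose s := perm f_inj.
have map_s : map s (L (supp x)) = L (supp y).
  case Lx : (L (supp x)) => [|e0 r].
    by apply/esym/size0nil; rewrite size_L -(size_L (supp x)) Lx.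
  rewrite -{}Lx; apply: (@eq_from_nth _ e0); first by rewrite size_map !size_L.
  move=> i; rewrite size_map => ix; rewrite (nth_map e0) // permE /f index_uniq //.
  by apply: set_nth_default; rewrite size_L -(size_L (supp x)).
have map_sl : map s (l (supp x)) = l (supp y).
  have := congr1 (take (size (l (supp y)))) map_s.
  by rewrite map_cat take_size_cat ?size_map // take_size_cat.
have s_supp : (s @: supp x)%SET = supp y.
  apply/setP => e; rewrite -[e](permKV s); set e' := (s^-1)%g e.
  rewrite (mem_imset _ _ (@perm_inj _ s)).
  have ml E u : (u \in l E) = (u \in E) by rewrite mem_filter mem_dfs_edges andbT.
  by rewrite -!ml -map_sl (mem_map (@perm_inj _ s)).
exists s.
  apply/ffunP => e; rewrite -[e](permKV s) reorder_actE; set e' := (s^-1)%g e.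
  have [xe'|xe'] := boolP (e' \in supp x); last first.
    move: (xe'); rewrite inE negbK => /eqP ->.
    move: xe'; rewrite -(mem_imset _ _ (@perm_inj _ s)) s_supp inE negbK.
    by move/eqP.
  have : map x (l (supp x)) = map (y \o s) (l (supp x)) by rewrite map_comp map_sl.
  by move/eq_in_map => /(_ e') /= -> //; rewrite mem_filter xe' mem_dfs_edges.
(* [xy] now serves only to say that the two shapes agree; the labels come from [x']. *)
move=> x' sx'; rewrite !collapsedE supp_reorder_act sx' s_supp; congr ONode.
apply/esym/(eq_forest_map xy); rewrite !labels_edge_labels -/(l _) -/(l _).
by rewrite -map_sl -map_comp; apply: eq_map => e /=; rewrite reorder_actE.
Qed.

Lemma oproj_eq (x y : pre) : oproj x = oproj y <-> collapsed x = collapsed y.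
Proof. by split=> [/eqmodP/asboolP|xy]; last exact/eqmodP/asboolP. Qed.

Lemma oproj_surj (a : oshape R d n t) : exists x : pre, oproj x = a.
Proof. by elim/quotW: a => x; exists x. Qed.

Lemma oproj_transport (x y : pre) : oproj x = oproj y ->
  exists2 s, y = reorder_act s x & transports oproj s x.
Proof.
move=> /oproj_eq/collapsed_transport[s ys sx]; exists s => // x' /sx sx'.
exact/oproj_eq.
Qed.

Definition shape_proj (x : pre) : ushape R d n t := uproj (oproj x).

(** Being related by a transporting permutation is symmetric and transitive and contains both
    collapses and reorderings, hence contains the equivalence they generate. *)
Lemma shape_proj_transport (x y : pre) : shape_proj x = shape_proj y ->
  exists2 s, y = reorder_act s x & transports shape_proj s x.
Proof.
move=> /eqmodP/asboolP.
pose tr (x y : pre) := exists2 s, y = reorder_act s x & transports shape_proj s x.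
have tr_oproj u v : oproj u = oproj v -> tr u v.
  move=> /oproj_transport[s vs su]; exists s => // x' /su sx'.
  by rewrite /shape_proj sx'.
have tr_sym u v : tr u v -> tr v u.
  move=> [s -> su]; exists s^-1%g; first by rewrite reorder_actM mulgV reorder_act1.
  move=> v' sv'; rewrite -su ?reorder_actM ?mulVg ?reorder_act1 //.
  rewrite supp_reorder_act sv' supp_reorder_act -imset_comp.
  by rewrite (eq_imset _ (permK s)) imset_id.
have tr_trans u v w : tr u v -> tr v w -> tr u w.
  move=> [s -> su] [s' -> sv]; exists (s * s')%g; first by rewrite reorder_actM.
  move=> u' su'; rewrite -reorder_actM sv ?su //.
  by rewrite !supp_reorder_act su'.
suff H a b : clos_refl_sym_trans _ reordered a b ->
    forall x y : pre, oproj x = a -> oproj y = b -> tr x y by move=> /H; apply.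
elim=> {a b} [a b [u [g [gG -> ->]]] x' y' xu yu|a x' y' <- /esym|a b _ IH x' y' xa yb
  |a b c _ IH1 _ IH2 x' y' xa yc].
- apply: tr_trans (tr_oproj _ _ xu) (tr_trans _ _ _ _ (tr_sym _ _ (tr_oproj _ _ yu))).
  exists g => // u' _; apply/eqmodP/asboolP/rst_sym/rst_step.
  by exists u', g.
- exact: tr_oproj.
- by apply/tr_sym/IH.
- have [z bE] := oproj_surj b.
  exact: tr_trans (IH1 _ _ xa bE) (IH2 _ _ bE yc).
Qed.

End Transport.

(** * Norms on the pre-shape space *)

Section Norms.

Variable R : realType.

(** Zero values are ignored, so the lemma applies to families of norms and differences some of which
    vanish. *)
Lemma pos_lower_bound (I : finType) (f : I -> R) :
  exists2 r, 0 < r & forall i, 0 < f i -> r <= f i.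
Proof.
have [r [r0 Hr]] : exists r : R, 0 < r /\
    forall i, i \in enum I -> 0 < f i -> r <= f i.
  elim: (enum I) => [|i s [r [r0 Hr]]]; first by exists 1.
  exists (Num.min r (if 0 < f i then f i else 1)); split.
    by rewrite lt_min r0; case: ifP => // _; exact: ltr01.
  move=> j; rewrite inE ge_min => /orP[/eqP -> fi|js fj]; last by rewrite Hr.
  by rewrite fi lexx orbT.
by exists r => // i; apply: Hr; rewrite mem_enum.
Qed.

Lemma cauchy_schwarz (I : finType) (a b : I -> R) :
  (\sum_i a i * b i) ^+ 2 <= (\sum_i a i ^+ 2) * (\sum_i b i ^+ 2).
Proof.
set A := \sum_i a i ^+ 2; set B := \sum_i b i ^+ 2; set C := \sum_i a i * b i.
have B_ge0 : 0 <= B by apply: sumr_ge0 => i _; exact: sqr_ge0.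
have [B0|B_neq0] := eqVneq B 0.
  have b0 i : b i = 0.
    have /psumr_eq0P/(_ i isT)/eqP : \sum_i b i ^+ 2 = 0 := B0.
    by rewrite sqrf_eq0 => /(_ (fun j _ => sqr_ge0 _))/eqP.
  suff -> : C = 0 by rewrite expr0n /= mulr_ge0 // sumr_ge0 // => i _; exact: sqr_ge0.
  by rewrite /C big1 // => i _; rewrite b0 mulr0.
have B_gt0 : 0 < B by rewrite lt_neqAle eq_sym B_neq0.
rewrite -subr_ge0 -(pmulr_rge0 _ B_gt0).
(* The right side is [B ^+ 2] times the squared length of the component of [a] orthogonal to [b]. *)
have -> : B * (A * B - C ^+ 2) = \sum_i (B * a i - C * b i) ^+ 2.
  rewrite (eq_bigr (fun i => B ^+ 2 * a i ^+ 2 + - (2 * B * C) * (a i * b i) +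
    C ^+ 2 * b i ^+ 2)); last by move=> i _; ring.
  by rewrite !big_split /= -!mulr_sumr -/A -/B -/C; ring.
by apply: sumr_ge0 => i _; exact: sqr_ge0.
Qed.

Definition l2norm (I : finType) (a : I -> R) : R := Num.sqrt (\sum_i a i ^+ 2).

Lemma sum_sqr_ge0 (I : finType) (a : I -> R) : 0 <= \sum_i a i ^+ 2.
Proof. by apply: sumr_ge0 => i _; exact: sqr_ge0. Qed.

Lemma l2norm_triangle (I : finType) (a b : I -> R) :
  l2norm (fun i => a i + b i) <= l2norm a + l2norm b.
Proof.
rewrite /l2norm; set A := \sum_i a i ^+ 2; set B := \sum_i b i ^+ 2.
have A0 : 0 <= A := sum_sqr_ge0 a; have B0 : 0 <= B := sum_sqr_ge0 b.
have AB : 0 <= Num.sqrt A + Num.sqrt B by rewrite addr_ge0 ?sqrtr_ge0.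
rewrite -[leRHS](ger0_norm AB) -sqrtr_sqr ler_wsqrtr // sqrrD !sqr_sqrtr //.
rewrite (eq_bigr (fun i => a i ^+ 2 + (a i * b i) *+ 2 + b i ^+ 2)); last first.
  by move=> i _; rewrite sqrrD.
rewrite !big_split /= -/A -/B lerD2r lerD2l. rewrite -mulr2n lerMn2r /=.
rewrite -sqrtrM // (le_trans (ler_norm _)) // -sqrtr_sqr ler_wsqrtr //.
exact: cauchy_schwarz.
Qed.

Lemma l2normZ (I : finType) (k : R) (a : I -> R) :
  l2norm (fun i => k * a i) = `|k| * l2norm a.
Proof.
rewrite /l2norm -sqrtr_sqr -sqrtrM ?sqr_ge0 // mulr_sumr.
by congr Num.sqrt; apply: eq_bigr => i _; rewrite exprMn.
Qed.

Lemma ler_l2norm (I : finType) (a b : I -> R) :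
  (forall i, 0 <= a i <= b i) -> l2norm a <= l2norm b.
Proof.
move=> ab; rewrite ler_wsqrtr // ler_sum // => i _.
by have /andP[a0 aib] := ab i; rewrite lerXn2r ?nnegrE ?(le_trans a0).
Qed.

Lemma norm_le_l2norm (I : finType) (a : I -> R) i : `|a i| <= l2norm a.
Proof.
rewrite -sqrtr_sqr ler_wsqrtr // (bigD1 i) //= lerDl.
by apply: sumr_ge0 => j _; exact: sqr_ge0.
Qed.

Variables d n : nat.
Implicit Types p q : 'M[R]_(n, d).

Lemma enormE p : enorm p = l2norm (fun ij : 'I_n * 'I_d => p ij.1 ij.2).
Proof. by rewrite /enorm pair_big. Qed.

Lemma enorm_ge0 p : 0 <= enorm p.
Proof. exact: sqrtr_ge0. Qed.

Lemma enorm_triangle p q : enorm (p + q) <= enorm p + enorm q.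
Proof.
rewrite !enormE; apply: le_trans (l2norm_triangle _ _).
by rewrite /l2norm; under eq_bigr do rewrite mxE.
Qed.

Lemma enormZ (k : R) p : enorm (k *: p) = `|k| * enorm p.
Proof.
by rewrite !enormE -l2normZ /l2norm; under eq_bigr do rewrite mxE.
Qed.

Lemma norm_le_enorm p i j : `|p i j| <= enorm p.
Proof. by rewrite enormE; exact: (norm_le_l2norm (fun ij => p ij.1 ij.2) (i, j)). Qed.

Lemma enorm0 : enorm (0 : 'M[R]_(n, d)) = 0.
Proof. by rewrite -(scale0r 0) enormZ normr0 mul0r. Qed.

Lemma enorm_gt0 p : (0 < enorm p) = (p != 0).
Proof.
apply/idP/idP => [|p0]; first by apply: contraTneq => ->; rewrite enorm0 ltxx.
rewrite lt_neqAle enorm_ge0 andbT eq_sym; apply: contraNneq p0 => p0.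
apply/eqP/matrixP => i j; apply/eqP; rewrite mxE -normr_le0.
by rewrite -p0 norm_le_enorm.
Qed.

Variable t : btree.
Local Notation pre := {ffun edge t -> 'M[R]_(n, d)}.

(** What QED and TED share: permutation invariance allows identifications to be undone, and
    domination of each attribute makes killing an edge costly. Domination also yields
    definiteness. *)
Definition shape_norm (N : pre -> R) : Prop :=
  [/\ forall u v, N (u + v) <= N u + N v, forall k u, N (k *: u) = `|k| * N u,
      forall (u : pre) e, enorm (u e) <= N u & forall s u, N (reorder_act s u) = N u].

Definition norm1 (u : pre) : R := \sum_e enorm (u e).
Definition norm2 (u : pre) : R := l2norm (fun e => enorm (u e)).

Lemma shape_norm1 : shape_norm norm1.
Proof.
split=> [u v|k u|u e|s u].
- by rewrite -big_split ler_sum //= => e _; rewrite ffunE enorm_triangle.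
- by rewrite /norm1 mulr_sumr; apply: eq_bigr => e _; rewrite ffunE enormZ.
- by rewrite /norm1 (bigD1 e) //= lerDl sumr_ge0 // => i _; exact: enorm_ge0.
- by rewrite /norm1 (reindex_inj (@perm_inj _ s)) /=;
    apply: eq_bigr => e _; rewrite reorder_actE.
Qed.

Lemma shape_norm2 : shape_norm norm2.
Proof.
split=> [u v|k u|u e|s u].
- apply: le_trans (l2norm_triangle _ _); apply: ler_l2norm => e.
  by rewrite enorm_ge0 ffunE enorm_triangle.
- rewrite /norm2 -(normr_id k) -l2normZ; congr l2norm; apply/funext => e.
  by rewrite ffunE enormZ.
- by rewrite -[leLHS]ger0_norm ?enorm_ge0 // (norm_le_l2norm (fun e => enorm (u e))).
- rewrite /norm2 /l2norm (reindex_inj (@perm_inj _ s)) /=; congr Num.sqrt.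
  by apply: eq_bigr => e _; rewrite reorder_actE.
Qed.

Lemma dist1E (x y : pre) : dist1 x y = norm1 (x - y).
Proof. by apply: eq_bigr => e _; rewrite !ffunE. Qed.

Lemma dist2E (x y : pre) : dist2 x y = norm2 (x - y).
Proof. by congr Num.sqrt; apply: eq_bigr => e _; rewrite !ffunE. Qed.

Section ShapeNormTheory.

Variables (N : pre -> R) (HN : shape_norm N).

Lemma snormD u v : N (u + v) <= N u + N v. Proof. by case: HN. Qed.
Lemma snormZ k u : N (k *: u) = `|k| * N u. Proof. by case: HN. Qed.
Lemma enorm_le_snorm (u : pre) e : enorm (u e) <= N u. Proof. by case: HN. Qed.
Lemma snorm_act s u : N (reorder_act s u) = N u. Proof. by case: HN. Qed.

Lemma snorm0 : N 0 = 0.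
Proof. by rewrite -(scale0r 0) snormZ normr0 mul0r. Qed.

Lemma snormB u v : N (u - v) = N (v - u).
Proof. by rewrite -opprB -scaleN1r snormZ normrN1 mul1r. Qed.

Lemma snorm_ge0 u : 0 <= N u.
Proof.
have := snormD u (- u); rewrite subrr snorm0 -(sub0r u) snormB subr0; lra.
Qed.

Lemma snorm_triangle v u w : N (u - w) <= N (u - v) + N (v - w).
Proof. by apply: le_trans (snormD _ _); rewrite addrA subrK. Qed.

Lemma snorm_eq0 u : N u = 0 -> u = 0.
Proof.
move=> u0; apply/ffunP => e; apply/eqP; rewrite ffunE -[_ == _]negbK -enorm_gt0.
by rewrite -leNgt -u0 enorm_le_snorm.
Qed.

End ShapeNormTheory.

End Norms.

(** * Charts of the quotient spaces *)

Section Charts.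

Variables (R : realType) (d n : nat) (t : btree).
Local Notation pre := {ffun edge t -> 'M[R]_(n, d)}.
Variable N : pre -> R.

(* [f] maps the [N]-ball of radius [r] around [x], in the space of pre-shapes
   supported in [E], isometrically onto the [rho]-ball of radius [r] around
   [f x]. *)
Definition chart (T : Type) (E : {set edge t}) (f : pre -> T) (D : set T)
    (rho : T -> T -> R) (x : pre) (r : R) : Prop :=
  [/\ supp x \subset E, 0 < r,
      forall v, supp v \subset E -> N (v - x) < r -> D (f v),
      forall v w, supp v \subset E -> supp w \subset E ->
        N (v - x) < r -> N (w - x) < r -> rho (f v) (f w) = N (v - w)
    & forall b, D b -> rho (f x) b < r ->
        exists2 v, supp v \subset E & b = f v /\ N (v - x) < r].

Hypothesis HN : shape_norm N.
Variables (Q : Type) (p : pre -> Q) (F : {set {set edge t}}).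
Variable rho : pre -> pre -> R.
Let Z : set pre := @rpreshape R d n t F.
Hypothesis p_transport : forall x y, p x = p y ->
  exists2 s, y = reorder_act s x & transports p s x.
Hypothesis rho_ge : forall x y, Z x -> Z y -> N (x - y) <= rho x y.
Hypothesis rho_le : forall E x y, E \in F -> supp x \subset E ->
  supp y \subset E -> rho x y <= N (x - y).

Lemma rpreshapeP (x : pre) : Z x <-> exists2 E, E \in F & supp x \subset E.
Proof.
split=> -[E EF xE]; exists E => //.
  by apply/fintype.subsetP => e; rewrite inE; apply: contraR => /xE ->.
by move=> e; apply: contraNeq => xe; apply: (fintype.subsetP xE); rewrite inE.
Qed.

Lemma supp_eq0 (x : pre) (E : {set edge t}) e : supp x \subset E -> e \notin E -> x e = 0.
Proof. by move=> xE; apply: contraNeq => xe; apply: (fintype.subsetP xE); rewrite inE. Qed.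

Lemma rho_ge0 x y : Z x -> Z y -> 0 <= rho x y.
Proof. by move=> Zx Zy; apply: le_trans (snorm_ge0 HN _) (rho_ge Zx Zy). Qed.

(* Points of the quotient near [p x] have representatives supported in [supp x]:
   no path from [p x] can branch into a subspace of larger support, and
   injectivity of the attributes makes these representatives unique. *)
Definition full_point (x : pre) : Prop :=
  [/\ Z x, {in supp x &, injective x}
    & forall y E, p y = p x -> E \in F -> supp y \subset E -> supp y = E].

(** * Lifting chains to the subspace of a full point *)

Section FullPoint.

Variables (x : pre) (r : R).
Hypothesis x_full : full_point x.
Hypothesis x_gt : forall e, e \in supp x -> 8 * r <= enorm (x e).
Hypothesis x_sep : forall e e', e \in supp x -> e' \in supp x -> e != e' ->
  8 * r <= enorm (x e - x e').

Lemma supp_near (y z : pre) c : (forall e, e \in supp y -> c <= enorm (y e)) ->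
  N (y - z) < c -> supp y \subset supp z.
Proof.
move=> yc yz; apply/fintype.subsetP => e ye; rewrite inE; apply/eqP => ze.
have := le_lt_trans (enorm_le_snorm HN (y - z) e) yz.
by rewrite !ffunE ze subr0 ltNge yc.
Qed.

Lemma supp_near_full v : N (v - x) < 8 * r -> supp v \subset supp x ->
  supp v = supp x.
Proof.
rewrite (snormB HN) => xv vx; apply/eqP; rewrite finset.eqEsubset vx.
exact: supp_near x_gt xv.
Qed.

Lemma full_supp_in_F : supp x \in F.
Proof.
have [Zx _ xmax] := x_full; have [E EF xE] := (rpreshapeP x).1 Zx.
by rewrite (xmax x E).
Qed.

(** The representatives differ by a permutation. If it moved [e] to another edge of the support, the
    attributes of [x] at these two edges would be closer than [4 * r + 4 * r], against [x_sep]. *)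
Lemma full_rep_injective v w : supp v = supp x -> supp w = supp x ->
  N (v - x) < 4 * r -> N (w - x) < 4 * r -> p v = p w -> v = w.
Proof.
move=> vx wx vr wr /p_transport[s ws _].
have s_id e : e \in supp x -> s e = e.
  move=> ex; apply/eqP; apply: contraT => se_e.
  have sex : s e \in supp x.
    by rewrite -wx ws supp_reorder_act vx mem_imset //; exact: perm_inj.
  have := x_sep sex ex se_e; rewrite leNgt => /negP[].
  have -> : x (s e) - x e = (x - w) (s e) + (v - x) e.
    by rewrite ws !ffunE permK addrA subrK.
  apply: le_lt_trans (enorm_triangle _ _) _.
  have := enorm_le_snorm HN (x - w) (s e); have := enorm_le_snorm HN (v - x) e.
  rewrite (snormB HN x); lra.
apply/ffunP => e; have [ex|ex] := boolP (e \in supp x).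
  by rewrite -(reorder_actE s v) -ws s_id.
by rewrite (supp_eq0 _ ex) ?vx // (supp_eq0 _ ex) ?wx.
Qed.

(** With [y = reorder_act s v], the lift of [z] is its image under the inverse of [s]. What needs
    proof is that [z] has exactly the support of [y]. *)
Lemma full_step v y z : supp v = supp x -> p v = p y -> Z z ->
  N (v - x) + N (y - z) < 8 * r ->
  exists w, [/\ supp w = supp x, p w = p z & N (v - w) = N (y - z)].
Proof.
move=> vx /p_transport[s -> sv] Zz vyz; have [_ _ xmax] := x_full.
have suppz : supp z = supp (reorder_act s v).
  (* No edge of [y] can vanish at [z]: its attribute has norm at least [8 * r - N (v - x)]. *)
  have [E EF zE] := (rpreshapeP z).1 Zz.
  have vz : supp (reorder_act s v) \subset supp z.
    apply: (@supp_near _ _ (8 * r - N (v - x))); last lra.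
    move=> e; rewrite -[e](permKV s) supp_reorder_act mem_imset; last exact: perm_inj.
    rewrite reorder_actE vx; set e' := (s^-1)%g e => e'x.
    have := x_gt e'x; have := enorm_triangle (v e') ((x - v) e').
    have := enorm_le_snorm HN (x - v) e'; rewrite (snormB HN x) !ffunE.
    by rewrite [v e' + _]addrC subrK; lra.
  (* Since [x] has the support of [v], [s] also transports [x]; maximality is applied to the
     representative [reorder_act s x] of [p x]. *)
  have sE : supp (reorder_act s v) = E.
    have -> : supp (reorder_act s v) = supp (reorder_act s x).
      by rewrite !supp_reorder_act vx.
    apply: xmax => //; first by rewrite sv.
    by apply: fintype.subset_trans zE; rewrite supp_reorder_act -vx -supp_reorder_act.
  by apply/eqP; rewrite finset.eqEsubset vz sE zE.
have suppw : supp (reorder_act s^-1%g z) = supp v.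
  rewrite supp_reorder_act suppz supp_reorder_act -imset_comp.
  by rewrite (eq_imset _ (permK s)) imset_id.
exists (reorder_act s^-1%g z); split; first by rewrite suppw.
  by rewrite -(sv _ suppw) reorder_actM mulVg reorder_act1.
rewrite -(snorm_act HN s); congr N; apply/ffunP => e.
by rewrite !ffunE invgK permKV.
Qed.

(** Each lifted step moves away from [x] by at most its own share of [s], so the bound [8 * r]
    passes on to the tail. *)
Lemma full_chain a b s : chain p Z rho a b s ->
  forall v, supp v = supp x -> p v = a -> N (v - x) + s < 8 * r ->
  exists w, [/\ supp w = supp x, p w = b & N (v - w) <= s].
Proof.
elim=> {a b s} [y z Zy Zz|y z b s Zy Zz zb IH] v vx vy vs.
  have := rho_ge Zy Zz => yz.
  have [|w [wx wz vw]] := @full_step v y z vx vy Zz; first lra.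
  by exists w; split=> //; rewrite vw.
have yz := rho_ge Zy Zz.
have s0 : 0 <= s by apply: chain_ge0 zb; exact: rho_ge0.
have [|w [wx wz vw]] := @full_step v y z vx vy Zz; first lra.
have wxN : N (w - x) <= N (v - w) + N (v - x).
  by rewrite (snormB HN v w); exact: snorm_triangle.
have [|u [ux ub wu]] := IH w wx wz; first lra.
exists u; split=> //; apply: le_trans (snorm_triangle HN w _ _) _.
by rewrite vw lerD.
Qed.

Lemma full_chart_r : 0 < r -> chart (supp x) p (p @` Z) (quot_dist p Z rho) x r.
Proof.
move=> r0; have xF := full_supp_in_F.
have ZE v : supp v \subset supp x -> Z v.
  by move=> vx; apply/rpreshapeP; exists (supp x).
have suppE v : supp v \subset supp x -> N (v - x) < r -> supp v = supp x.
  by move=> vx vr; apply: supp_near_full => //; lra.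
split=> // [v vx _|v w vx wx vr wr|b Db].
- by exists v => //; exact: ZE.
- have Zv := ZE v vx; have Zw := ZE w wx.
  apply/eqP; rewrite eq_le; apply/andP; split.
    apply: le_trans (quot_dist_proj _ _ Zv Zw) (rho_le xF vx wx).
    exact: rho_ge0.
  apply: quot_dist_ge; [by exists v|by exists w|] => s vws.
  (* A chain shorter than [N (v - w)] would have a lift ending within [3 * r] of [x], where
     representatives are unique; the lift would end at [w] itself. *)
  have vwr : N (v - w) < 2 * r.
    have := snorm_triangle HN x v w; rewrite (snormB HN x w); lra.
  rewrite leNgt; apply/negP => svw.
  have [|w' [w'x pw vw']] := full_chain vws (suppE v vx vr) erefl; first lra.
  move: (svw); rewrite ltNge (_ : w = w') ?vw' //; apply: full_rep_injective => //.
  + exact: suppE.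
  + lra.
  + have := snorm_triangle HN v w' x; rewrite (snormB HN w' v); lra.
- have Zx := ZE x (fintype.subxx _); move=> br.
  have Dx : (p @` Z) (p x) by exists x.
  have [s xbs sr] := quot_dist_lt Dx Db br.
  have [|w [wx pw xw]] := full_chain xbs erefl erefl.
    by rewrite subrr (snorm0 HN); lra.
  exists w; rewrite ?wx //; split=> //.
  by rewrite (snormB HN); apply: le_lt_trans sr.
Qed.

(** This gives openness. Maximality passes from [x] to [v] because a permutation identifying [v]
    with another pre-shape does the same to [x]. *)
Lemma full_near v : N (v - x) < 4 * r -> supp v \subset supp x -> full_point v.
Proof.
move=> vr vx; have [Zx x_inj xmax] := x_full.
have r0 : 0 < r by have := snorm_ge0 HN (v - x); lra.
have sv : supp v = supp x by apply: supp_near_full => //; lra.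
split=> [|e e'|y E].
- by apply/rpreshapeP; exists (supp x) => //; exact: full_supp_in_F.
- rewrite sv => ex ex' vee'; apply/eqP; apply: contraT => ee'.
  have := x_sep ex ex' ee'; rewrite leNgt => /negP[].
  have -> : x e - x e' = (x - v) e + (v - x) e'.
    by rewrite !ffunE vee' addrA subrK.
  apply: le_lt_trans (enorm_triangle _ _) _.
  have := enorm_le_snorm HN (x - v) e; have := enorm_le_snorm HN (v - x) e'.
  rewrite (snormB HN x); lra.
- move=> /esym/p_transport[s -> sx] EF yE.
  have sE : supp (reorder_act s v) = supp (reorder_act s x).
    by rewrite !supp_reorder_act sv.
  by rewrite sE; apply: xmax => //; [rewrite sx|rewrite -sE].
Qed.

End FullPoint.

Lemma full_chart x : full_point x -> exists r,
  chart (supp x) p (p @` Z) (quot_dist p Z rho) x r /\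
  forall v, supp v \subset supp x -> N (v - x) < r -> full_point v.
Proof.
move=> x_full; have [_ x_inj _] := x_full.
have [r1 r10 Hr1] := pos_lower_bound (fun e => enorm (x e)).
have [r2 r20 Hr2] := pos_lower_bound (fun e : edge t * edge t => enorm (x e.1 - x e.2)).
(* The factor 8 comes from [full_rep_injective], where two representatives may each be [4 * r] away
   from [x]. *)
set r := Num.min r1 r2 / 8.
have r0 : 0 < r by rewrite divr_gt0 // lt_min r10.
have x_gt e : e \in supp x -> 8 * r <= enorm (x e).
  move=> ex; rewrite mulrC divfK // ge_min; apply/orP; left.
  by apply: Hr1; rewrite enorm_gt0; rewrite inE in ex.
have x_sep e e' : e \in supp x -> e' \in supp x -> e != e' ->
    8 * r <= enorm (x e - x e').
  move=> ex ex' ee'; rewrite mulrC divfK // ge_min; apply/orP; right.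
  apply: (Hr2 (e, e')); rewrite enorm_gt0 subr_eq0; apply: contraNneq ee' => xee'.
  exact/eqP/x_inj.
exists r; split; first exact: full_chart_r.
by move=> v vx vr; apply: full_near x_full x_gt x_sep _ _ vx; lra.
Qed.

(** The pre-shape [y] is shifted by a small multiple of [u], which carries distinct positive
    constants on [E]. A single matrix entry then tells all attributes apart from 0 and from each
    other. *)
Lemma perturb (hd : (0 < d)%N) (hn : (0 < n)%N) (y : pre) (E : {set edge t}) (c : R) :
  supp y \subset E -> 0 < c ->
  exists z, [/\ supp z = E, {in E &, injective z} & N (y - z) < c].
Proof.
move=> yE c0.
pose i0 := Ordinal hn; pose j0 := Ordinal hd.
pose k (e : edge t) : R := (enum_rank e).+1%:R.
pose u : pre := [ffun e => if e \in E then const_mx (k e) else 0].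
pose K : R := #|edge t|.+1%:R.
have k_gt0 e : 0 < k e by rewrite ltr0n.
have k_le e : k e <= K by rewrite ler_nat ltnS ltnW // ltn_ord.
have k_inj : injective k.
  by move=> e e' /eqP; rewrite eqr_nat eqSS => /eqP/val_inj/enum_rank_inj.
have K_gt0 : 0 < K by rewrite ltr0n.
have [r1 r10 Hr1] := pos_lower_bound (fun e => `|y e i0 j0|).
have [r2 r20 Hr2] := pos_lower_bound
  (fun e : edge t * edge t => `|y e.1 i0 j0 - y e.2 i0 j0|).
have Nu0 : 0 < N u + 1 by rewrite ltr_wpDl ?snorm_ge0.
(* The three bounds prevent entries from cancelling, prevent different entries from meeting, and
   keep the shift below [c]. The [+ 1] covers [u = 0], when [E] is empty. *)
set m := Num.min (Num.min (r1 / K) (r2 / K)) (c / (N u + 1)).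
have m0 : 0 < m by rewrite !lt_min !divr_gt0.
have [m1 m2 m3] : [/\ m <= r1 / K, m <= r2 / K & m <= c / (N u + 1)].
  by rewrite !ge_min !lexx !orbT.
pose a := m / 2; have a0 : 0 < a by rewrite divr_gt0.
have am : a < m by rewrite /a; lra.
(* Either [b] vanishes and [a * l] remains, or [b] is too large to be cancelled by [a * l]. *)
have nonzero (b l s : R) : (0 < `|b| -> s <= `|b|) -> l != 0 -> `|l| <= K ->
    m <= s / K -> b + a * l != 0.
  move=> sb l0 lK; rewrite ler_pdivlMr // => msK.
  have [b0|b0] := eqVneq b 0; first by rewrite b0 add0r mulf_neq0 // gt_eqF.
  rewrite addr_eq0; apply/eqP => bl.
  have: s <= a * `|l|.
    by rewrite -{1}(gtr0_norm a0) -normrM -normrN -bl sb // normr_gt0.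
  rewrite leNgt => /negP; apply; apply: lt_le_trans msK.
  by apply: le_lt_trans (_ : a * K < _); rewrite ?ler_pM2l ?ltr_pM2r.
have zE e : e \in E -> (y + a *: u) e i0 j0 = y e i0 j0 + a * k e.
  by move=> eE; rewrite !ffunE eE !mxE.
exists (y + a *: u); split.
- apply/setP => e; rewrite inE; have [eE|eE] := boolP (e \in E); last first.
    by rewrite !ffunE (negbTE eE) scaler0 addr0 (supp_eq0 yE eE) eqxx.
  apply: contraTneq (nonzero (y e i0 j0) (k e) r1 (Hr1 e) _ _ m1) => [ze||].
  + by rewrite -zE // ze mxE eqxx.
  + by rewrite gt_eqF.
  + by rewrite gtr0_norm.
- move=> e e' eE eE' /(congr1 (fun M : 'M[R]_(n, d) => M i0 j0)); rewrite !zE // => zz.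
  apply/eqP; apply: contraT => ee'.
  suff : y e i0 j0 - y e' i0 j0 + a * (k e - k e') != 0.
    by move=> /eqP[]; rewrite mulrBr; lra.
  apply: nonzero (Hr2 (e, e')) _ _ m2; first by rewrite subr_eq0 (inj_eq k_inj).
  have := k_gt0 e; have := k_gt0 e'; have := k_le e; have := k_le e'.
  by rewrite ler_norml => *; apply/andP; split; lra.
- rewrite (snormB HN) [_ - y]addrC addKr (snormZ HN) (gtr0_norm a0).
  apply: lt_le_trans (_ : m * (N u + 1) <= _); last by rewrite -ler_pdivlMr.
  apply: le_lt_trans (_ : a * (N u + 1) < _); last by rewrite ltr_pM2r.
  by rewrite ler_pM2l // lerDl.
Qed.

(** Permutations preserve the size of supports, so no representative of [p x] fits properly into an
    allowed set. *)
Lemma full_point_max (x : pre) :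
  supp x \in F -> {in supp x &, injective x} ->
  (forall E y, E \in F -> p y = p x -> supp y \subset E -> (#|E| <= #|supp x|)%N) ->
  full_point x.
Proof.
move=> xF x_inj xmax; split=> // [|y E yx EF yE].
  by apply/rpreshapeP; exists (supp x).
apply/eqP; rewrite eqEcard yE (leq_trans (xmax _ _ EF yx yE)) //.
have [s -> _] := p_transport (esym yx).
by rewrite supp_reorder_act card_imset //; exact: perm_inj.
Qed.

(** Maximal members of [F] may differ in size, so the largest one is sought only among the subspaces
    whose image meets the given ball; a perturbation inside that subspace is full. *)
Lemma full_points_dense (hd : (0 < d)%N) (hn : (0 < n)%N) (x : pre) (c : R) :
  Z x -> 0 < c -> exists2 y, full_point y & quot_dist p Z rho (p x) (p y) < c.
Proof.
move=> Zx c0.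
have Zin v E : E \in F -> supp v \subset E -> Z v by move=> *; apply/rpreshapeP; exists E.
have Dp v : Z v -> (p @` Z) (p v) by exists v.
have qdxx : quot_dist p Z rho (p x) (p x) < c.
  have [E EF xE] := (rpreshapeP x).1 Zx.
  apply: le_lt_trans (quot_dist_proj _ _ Zx Zx) _; first exact: rho_ge0.
  by apply: le_lt_trans (rho_le EF xE xE) _; rewrite subrr (snorm0 HN).
pose near E := (E \in F) &&
  `[< exists2 v, supp v \subset E & quot_dist p Z rho (p x) (p v) < c >].
have [E0 nearE0] : exists E, near E.
  have [E EF xE] := (rpreshapeP x).1 Zx.
  by exists E; rewrite /near EF; apply/asboolP; exists x.
have [E /andP[EF /asboolP[v vE xv]] Emax] := arg_maxnP (fun E : {set edge t} => #|E|) nearE0.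
have [y [yE y_inj vy]] : exists y, [/\ supp y = E, {in E &, injective y} &
    N (v - y) < c - quot_dist p Z rho (p x) (p v)].
  by apply: perturb => //; lra.
have Zv := Zin v E EF vE; have Zy : Z y by apply: Zin EF _; rewrite yE.
have xy : quot_dist p Z rho (p x) (p y) < c.
  have vyN : quot_dist p Z rho (p v) (p y) <= N (v - y).
    apply: le_trans (quot_dist_proj _ _ Zv Zy) _; first exact: rho_ge0.
    by apply: rho_le EF _ _; rewrite ?yE.
  have := quot_dist_triangle rho_ge0 (Dp x Zx) (Dp v Zv) (Dp y Zy); lra.
exists y => //; apply: full_point_max; rewrite ?yE // => E' y' E'F y'y y'E'.
by apply: Emax; rewrite /near E'F; apply/asboolP; exists y'; rewrite ?y'y.
Qed.

Lemma full_chart_generic (hd : (0 < d)%N) (hn : (0 < n)%N) (P : Q -> Prop) :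
  (forall x r, chart (supp x) p (p @` Z) (quot_dist p Z rho) x r -> P (p x)) ->
  generic (p @` Z) (quot_dist p Z rho) P.
Proof.
move=> HP; exists (p @` full_point); split.
- split=> [_ [x [Zx _ _] <-]|_ [x x_full <-]]; first by exists x.
  have [r [[_ r0 _ _ x_onto] near_full]] := full_chart x_full.
  split=> [_ [y [Zy _ _] <-]|]; first by exists y.
  exists r => // b [Db xb]; have [v vx [-> vr]] := x_onto b Db xb.
  by exists v => //; exact: near_full.
- move=> _ [x Zx <-] r r0; have [y y_full xy] := full_points_dense hd hn Zx r0.
  exists (p y); first by exists y.
  by split=> //; exists y => //; case: y_full.
- move=> _ [x /full_chart[r [xr _]] <-]; exact: HP xr.
Qed.

End Charts.

(** * The length metric of a restricted pre-shape space *)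

Section LengthMetric.

Variables (R : realType) (d n : nat) (t : btree).
Local Notation pre := {ffun edge t -> 'M[R]_(n, d)}.
Variable N : pre -> R.
Hypothesis HN : shape_norm N.
Let dN (x y : pre) := N (x - y).

Lemma itv_partition01P (s : seq R) : itv_partition 0 1 s ->
  [/\ forall i, (i < size s)%N -> nth 1 (0 :: s) i < nth 1 (0 :: s) i.+1,
      nth 1 (0 :: s) (size s) = 1
    & forall i, (i <= size s)%N -> nth 1 (0 :: s) i \in `[0, 1] ].
Proof.
move=> s01; have [/pathP H _] := s01; split.
- by move=> i /(H 1).
- exact: itv_partition_nth_size s01.
- move=> i is_; rewrite in_itv /=.
  by rewrite (itv_partition_nth_ge _ s01) //= (itv_partition_nth_le _ s01).
Qed.

Lemma path_length_ge (g : R -> pre) : ((N (g 0 - g 1))%:E <= path_length dN g)%E.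
Proof.
apply: ereal_sup_ubound; exists [:: 1]; first exact: itv_partition1.
by rewrite /= big_nat1.
Qed.

Lemma lipschitz_path (D : set pre) (g : R -> pre) (L : R) :
  (forall u, u \in `[0, 1] -> D (g u)) ->
  (forall u v, u \in `[0, 1] -> v \in `[0, 1] -> N (g u - g v) <= L * `|u - v|) ->
  path_in D dN (g 0) (g 1) g /\
  exists2 l, path_length dN g = l%:E & l <= L.
Proof.
move=> Dg gL.
have L0 : 0 <= L.
  have := gL 0 1; rewrite sub0r normrN normr1 mulr1 !in_itv /= ler01 !lexx => gL1.
  exact: le_trans (snorm_ge0 HN _) (gL1 isT isT).
split.
  split=> // u u01 e e0; exists (e / (L + 1)); first by rewrite divr_gt0 ?ltr_wpDl.
  move=> v v01; rewrite ltr_pdivlMr ?ltr_wpDl // => vu.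
  apply: le_lt_trans (gL _ _ v01 u01) (le_lt_trans _ vu).
  by rewrite mulrC ler_wpM2l // lerDl.
have le_L : (path_length dN g <= L%:E)%E.
  apply: ge_ereal_sup => _ [s s01 <-]; rewrite lee_fin.
  have [s_lt s1 s_in] := itv_partition01P s01.
  apply: le_trans (_ : L * (nth 1 (0 :: s) (size s) - 0) <= _); last first.
    by rewrite s1 subr0 mulr1.
  rewrite -[X in _ - X]/(nth 1 (0 :: s) 0) -telescope_sumr // mulr_sumr.
  apply: ler_sum_nat => i /andP[_ i_s].
  apply: le_trans (gL _ _ _ _) _; [exact/s_in/ltnW|exact: s_in|].
  by rewrite distrC gtr0_norm // subr_gt0 s_lt.
have := path_length_ge g; move: le_L; case: (path_length dN g) => //= l.
by rewrite lee_fin => lL _; exists l.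
Qed.

Definition segment (x y : pre) (u : R) : pre := x + u *: (y - x).

Lemma segmentB x y u v : N (segment x y u - segment x y v) = `|u - v| * N (x - y).
Proof.
rewrite /segment opprD addrACA subrr add0r -scalerBl (snormZ HN) (snormB HN y).
by [].
Qed.

Lemma supp_segment (E : {set edge t}) x y u :
  supp x \subset E -> supp y \subset E -> supp (segment x y u) \subset E.
Proof.
move=> xE yE; apply/fintype.subsetP => e; rewrite inE; apply: contraR => eE.
by rewrite !ffunE (supp_eq0 xE eE) (supp_eq0 yE eE) subrr scaler0 addr0.
Qed.

Variable F : {set {set edge t}}.
Let Z : set pre := @rpreshape R d n t F.
Let len := length_dist Z dN.

Lemma length_dist_le E x y : E \in F -> supp x \subset E -> supp y \subset E ->
  len x y <= N (x - y).
Proof.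
move=> EF xE yE.
have seg0 : segment x y 0 = x by rewrite /segment scale0r addr0.
have seg1 : segment x y 1 = y by rewrite /segment scale1r addrC subrK.
have [||path_xy [l xyl lN]] := @lipschitz_path Z (segment x y) (N (x - y)).
- by move=> u _; apply/rpreshapeP; exists E => //; exact: supp_segment.
- by move=> u v _ _; rewrite segmentB mulrC.
rewrite seg0 seg1 in path_xy.
apply: le_trans lN; apply: ge_inf; last by exists (segment x y).
exists 0 => l' [g _ gl]; have := path_length_ge g.
by rewrite gl lee_fin; apply: le_trans; exact: snorm_ge0.
Qed.

(* Z is star-shaped around 0, hence path-connected. *)
Lemma rectifiable x y : Z x -> Z y ->
  exists l g, path_in Z dN x y g /\ path_length dN g = l%:E.
Proof.
move=> /rpreshapeP[E EF xE] /rpreshapeP[E' E'F yE'].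
pose g (u : R) : pre := Num.max 0 (1 - 2 * u) *: x + Num.max 0 (2 * u - 1) *: y.
have g0 : g 0 = x.
  by rewrite /g mulr0 subr0 sub0r max_r // max_l ?scale1r ?scale0r ?addr0 // oppr_le0.
have g1 : g 1 = y.
  by rewrite /g mulr1 max_l ?max_r ?scale0r ?add0r;
    [rewrite (_ : 2 - 1 = 1) ?scale1r //; ring|lra..].
have [||gxy [l gl _]] := @lipschitz_path Z g (2 * N x + 2 * N y).
- move=> u _; apply/rpreshapeP; have [u2|u2] := leP (2 * u) 1.
    exists E => //; apply/fintype.subsetP => e; rewrite inE; apply: contraR => eE.
    have m0 : Num.max 0 (2 * u - 1) = 0 by rewrite max_l //; lra.
    by rewrite !ffunE (supp_eq0 xE eE) m0 scaler0 scale0r addr0.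
  exists E' => //; apply/fintype.subsetP => e; rewrite inE; apply: contraR => eE.
  have m0 : Num.max 0 (1 - 2 * u) = 0 by rewrite max_l //; lra.
  by rewrite !ffunE (supp_eq0 yE' eE) m0 scaler0 scale0r addr0.
- move=> u v _ _; rewrite /g opprD addrACA -!scalerBl.
  apply: le_trans (snormD HN _ _) _; rewrite !(snormZ HN) [leRHS]mulrDl.
  have Hmax (a b : R) : `|Num.max 0 a - Num.max 0 b| <= `|a - b|.
    by case: (lerP 0 a) => ?; case: (lerP 0 b) => ?; rewrite ler_norml;
      have := ler_norm (a - b); have := ler_norm (b - a); rewrite (distrC b) => *;
      apply/andP; split; lra.
  have NE (w : pre) : 2 * N w * `|u - v| = `|2 * (u - v)| * N w.
    by rewrite normrM ger0_norm // mulrAC.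
  rewrite !NE; apply: lerD; apply: ler_wpM2r; rewrite ?snorm_ge0 //.
    by apply: le_trans (Hmax _ _) _; rewrite -normrN le_eqVlt; apply/orP; left;
      apply/eqP; congr `|_|; ring.
  by apply: le_trans (Hmax _ _) _; rewrite le_eqVlt; apply/orP; left;
    apply/eqP; congr `|_|; ring.
by exists l, g; rewrite -{1}g0 -{1}g1.
Qed.

Lemma length_dist_ge x y : Z x -> Z y -> N (x - y) <= len x y.
Proof.
move=> Zx Zy; apply: lb_le_inf.
  by have [l [g [xy gl]]] := rectifiable Zx Zy; exists l, g.
by move=> l [g [g0 g1 _ _]]; have := path_length_ge g => + gl; rewrite gl g0 g1.
Qed.

Lemma path_length_rev_le (g : R -> pre) :
  (path_length dN (fun u => g (1 - u)%R) <= path_length dN g)%E.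
Proof.
apply: ge_ereal_sup => _ [s s01 <-]; apply: ereal_sup_ubound.
have [s_lt s1 s_in] := itv_partition01P s01.
(* An [itv_partition] list omits the left end 0 and contains the right end 1. Reflection exchanges
   the ends, hence the reading of [0 :: s] with index shifted by one. *)
pose s' := mkseq (fun i => 1 - nth 1 (0 :: s) (size s - i.+1)) (size s).
have size_s' : size s' = size s by rewrite size_mkseq.
have s'E i : (i <= size s)%N -> nth 1 (0 :: s') i = 1 - nth 1 (0 :: s) (size s - i).
  case: i => [|i] is_; first by rewrite subn0 s1 subrr.
  by rewrite [LHS]/= nth_mkseq.
exists s'.
  split; last by rewrite (last_nth 1) size_s' s'E // subnn subr0.
  apply/(pathP 1) => i; rewrite size_s' => is_.
  rewrite -[nth 1 s' i]/(nth 1 (0 :: s') i.+1) !s'E //; last exact: ltnW.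
  rewrite ltrD2l ltrN2.
  by rewrite -[(size s - i)%N]prednK ?subn_gt0 // -subnS s_lt // subnS prednK ?subn_gt0 // leq_subr.
congr _%:E; rewrite /= size_s' [LHS]big_nat_rev add0n.
rewrite !big_nat; apply: eq_bigr => i /andP[_ is_].
rewrite /dN (snormB HN) s'E ?leq_subr // subKn //.
by rewrite nth_mkseq ?subnSK ?subKn ?leq_subr // ltnW.
Qed.

Lemma length_distC x y : len x y = len y x.
Proof.
suff H a b l : (exists2 g, path_in Z dN a b g & path_length dN g = l%:E) ->
    exists2 g, path_in Z dN b a g & path_length dN g = l%:E.
  by congr inf; apply/seteqP; split=> l; exact: H.
move=> [g [g0 g1 Zg gC] gl]; exists (fun u => g (1 - u)).
  have r01 (u : R) : u \in `[0, 1] -> 1 - u \in `[0, 1].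
    by rewrite !in_itv /= => /andP[? ?]; apply/andP; split; lra.
  split; [by rewrite subr0|by rewrite subrr|by move=> u /r01/Zg|].
  move=> u /r01 u01 e e0; have [c c0 Hc] := gC _ u01 e e0.
  exists c => // v /r01 v01 vu; apply: Hc => //.
  by rewrite (_ : 1 - v - (1 - u) = u - v) 1?distrC //; ring.
rewrite -gl; apply/eqP; rewrite eq_le path_length_rev_le /=.
have := path_length_rev_le (fun u => g (1 - u)).
by rewrite (_ : (fun u => g (1 - (1 - u))) = g) //; apply/funext => u;
  rewrite opprB addrC subrK.
Qed.

End LengthMetric.

(** * Averages in Euclidean charts *)

Section EuclideanIdentities.

Variables (R : realType) (d n : nat) (t : btree).
Local Notation pre := {ffun edge t -> 'M[R]_(n, d)}.
Local Notation N := (@norm2 R d n t).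
Local Notation coord := (edge t * ('I_n * 'I_d))%type.

Lemma norm2E (u : pre) : N u = l2norm (fun k : coord => u k.1 k.2.1 k.2.2).
Proof.
rewrite /norm2 /l2norm -(pair_big xpredT xpredT
  (fun e (ij : 'I_n * 'I_d) => u e ij.1 ij.2 ^+ 2)) /=.
congr Num.sqrt; apply: eq_bigr => e _; rewrite enormE sqr_sqrtr //.
exact: sum_sqr_ge0.
Qed.

Lemma sqr_norm2 (u : pre) : N u ^+ 2 = \sum_(k : coord) u k.1 k.2.1 k.2.2 ^+ 2.
Proof. by rewrite norm2E sqr_sqrtr // sum_sqr_ge0. Qed.

(** Stewart's theorem. At [a = 1 / 2] it drives the uniqueness of circumcenters; for general [a] it
    forces geodesics to be segments. *)
Lemma stewart (u v w : pre) (a : R) :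
  N (u - segment v w a) ^+ 2 =
  (1 - a) * N (u - v) ^+ 2 + a * N (u - w) ^+ 2 - a * (1 - a) * N (v - w) ^+ 2.
Proof.
rewrite !sqr_norm2 !mulr_sumr -sumrN -!big_split /=; apply: eq_bigr => k _.
by rewrite !ffunE !mxE; ring.
Qed.

(** The parallel axis identity, from which both existence and uniqueness of Euclidean means are read
    off. *)
Lemma sum_sqr_norm2 (T : Type) (s : seq T) (a : T -> pre) (v m : pre) :
  (size s)%:R *: m = \sum_(y <- s) a y ->
  \sum_(y <- s) N (v - a y) ^+ 2 =
  (size s)%:R * N (v - m) ^+ 2 + \sum_(y <- s) N (m - a y) ^+ 2.
Proof.
move=> mE.
have sumE w : \sum_(y <- s) N (w - a y) ^+ 2 =
    \sum_(k : coord) \sum_(y <- s) (w k.1 k.2.1 k.2.2 - a y k.1 k.2.1 k.2.2) ^+ 2.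
  rewrite exchange_big /=; apply: eq_bigr => y _; rewrite sqr_norm2.
  by apply: eq_bigr => k _; rewrite !ffunE !mxE.
rewrite !sumE sqr_norm2 mulr_sumr -big_split /=; apply: eq_bigr => -[e [i j]] _ /=.
have mk : (size s)%:R * m e i j = \sum_(y <- s) a y e i j.
  have := congr1 (fun u : pre => u e i j) mE.
  by rewrite !ffunE mxE => ->; rewrite sum_ffunE summxE.
rewrite !ffunE !mxE (eq_bigr (fun y => (m e i j - a y e i j) ^+ 2 +
  ((v e i j - m e i j) * (v e i j + m e i j) -
   2 * (v e i j - m e i j) * a y e i j))); last by move=> y _; ring.
rewrite big_split sumrB /= -[X in _ + (_ - X) = _]mulr_sumr -mk big_const_seq.
rewrite count_predT iter_addr_0.
by rewrite -[_ *+ size s]mulr_natl; ring.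
Qed.

Lemma norm2_le_coord (u : pre) (c : R) : (forall e i j, `|u e i j| <= c) ->
  N u <= c * l2norm (fun _ : coord => 1).
Proof.
move=> uc.
(* Without coordinates [c] may be negative, but then both sides are 0. *)
have [k0|/card_gt0P[[e [i j]] _]] := posnP #|{: coord}|.
  rewrite norm2E /l2norm !big_pred0 ?sqrtr0 ?mulr0 // => k;
  by have /card0_eq/(_ k) := k0.
have c0 : 0 <= c := le_trans (normr_ge0 _) (uc e i j).
rewrite norm2E -[c]ger0_norm // -l2normZ.
have -> : l2norm (fun k : coord => u k.1 k.2.1 k.2.2) =
    l2norm (fun k : coord => `|u k.1 k.2.1 k.2.2|).
  by congr Num.sqrt; apply: eq_bigr => k _; rewrite real_normK ?num_real.
by apply: ler_l2norm => k; rewrite normr_ge0 mulr1 uc.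
Qed.

Lemma coord_le_norm2 (u : pre) e i j : `|u e i j| <= N u.
Proof.
apply: le_trans (norm_le_enorm _ _ _) _.
exact: (enorm_le_snorm (@shape_norm2 R d n t)).
Qed.

End EuclideanIdentities.

(** * Smallest enclosing balls of bounded, possibly infinite, sets *)

Section Circumradius.

Variables (R : realType) (d n : nat) (t : btree).
Local Notation pre := {ffun edge t -> 'M[R]_(n, d)}.
Local Notation N := (@norm2 R d n t).
Let HN : shape_norm N := @shape_norm2 R d n t.
Variables (E : {set edge t}) (A : set pre).
Hypotheses (A_neq0 : A !=set0) (A_bounded : exists v r,
  supp v \subset E /\ forall a, A a -> N (v - a) <= r).

Let covers (v : pre) (r : R) := supp v \subset E /\ forall a, A a -> N (v - a) <= r.

Lemma circumradius_exists : exists r0, 0 <= r0 /\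
  (forall v r, covers v r -> r0 <= r) /\
  forall e, 0 < e -> exists v r, covers v r /\ r < r0 + e.
Proof.
pose S := [set r | exists v, covers v r].
have S_ge0 r : S r -> 0 <= r.
  move=> [v [_ vr]]; have [a Aa] := A_neq0.
  exact: le_trans (snorm_ge0 HN _) (vr a Aa).
have S0 : S !=set0 by have [v [r vr]] := A_bounded; exists r, v.
have Slb : has_lbound S by exists 0.
exists (inf S); split; first exact: lb_le_inf.
split=> [v r vr|e e0]; first by apply: ge_inf => //; exists v.
by have [r [v vr] re] := inf_adherent e0 (conj S0 Slb); exists v, r.
Qed.

Variable r0 : R.
Hypotheses (r0_ge0 : 0 <= r0) (r0_le : forall v r, covers v r -> r0 <= r).

(* The midpoint of the centers of two covering balls is the center of a smaller
   covering ball. *)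
Lemma covers_close v w r r' : covers v r -> covers w r' ->
  N (v - w) ^+ 2 <= 2 * (r ^+ 2 - r0 ^+ 2) + 2 * (r' ^+ 2 - r0 ^+ 2).
Proof.
move=> [vE vr] [wE wr]; pose m := segment v w 2^-1.
pose q := (r ^+ 2 + r' ^+ 2) / 2 - N (v - w) ^+ 2 / 4.
have mq a : A a -> N (m - a) ^+ 2 <= q.
  move=> Aa; rewrite (snormB HN) stewart (snormB HN a v) (snormB HN a w).
  have := vr a Aa; have := wr a Aa.
  rewrite -(ler_pXn2r (_ : 0 < 2)%N) ?nnegrE ?(snorm_ge0 HN) //; last first.
    exact: le_trans (snorm_ge0 HN _) (wr a Aa).
  rewrite -(ler_pXn2r (_ : 0 < 2)%N (_ : N (v - a) \in _)) ?nnegrE ?(snorm_ge0 HN) //.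
    by rewrite /q; set X := N (v - w); lra.
  exact: le_trans (snorm_ge0 HN _) (vr a Aa).
have q0 : 0 <= q by have [a Aa] := A_neq0; apply: le_trans (sqr_ge0 _) (mq a Aa).
have : r0 <= Num.sqrt q.
  apply: (r0_le (v := m)); split; first exact: supp_segment.
  move=> a Aa; rewrite -[leLHS]ger0_norm ?(snorm_ge0 HN) // -sqrtr_sqr.
  exact/ler_wsqrtr/mq.
rewrite -(ler_pXn2r (_ : 0 < 2)%N) ?nnegrE ?sqrtr_ge0 // sqr_sqrtr // /q; lra.
Qed.

(** By [covers_close], centers of nearly minimal covering balls are close to each other. Their limit
    is built coordinatewise as an infimum, without choosing a sequence. *)
Lemma covers_min : (forall e, 0 < e -> exists v r, covers v r /\ r < r0 + e) ->
  exists v, covers v r0.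
Proof.
move=> r0_inf.
pose h r := Num.sqrt (2 * (r ^+ 2 - r0 ^+ 2)).
have hr_ge0 v r : covers v r -> 0 <= 2 * (r ^+ 2 - r0 ^+ 2).
  move=> /r0_le r0r; rewrite mulr_ge0 // subr_ge0 lerXn2r ?nnegrE //.
  exact: le_trans r0r.
have close v w r r' : covers v r -> covers w r' -> N (v - w) <= h r + h r'.
  move=> vr wr; rewrite -[leLHS]ger0_norm ?(snorm_ge0 HN) //.
  rewrite -[leRHS]ger0_norm ?addr_ge0 ?sqrtr_ge0 // -ler_sqr ?nnegrE ?normr_ge0 //.
  rewrite !real_normK ?num_real //; apply: le_trans (covers_close vr wr) _.
  rewrite sqrrD !sqr_sqrtr; [|exact: hr_ge0 wr|exact: hr_ge0 vr].
  by rewrite lerD2r lerDl mulrn_wge0 // mulr_ge0 ?sqrtr_ge0.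
(* By [close], all [v e i j + h r] lie above all [v e i j - h r]. *)
pose X e i j := [set y | exists v r, covers v r /\ y = v e i j + h r].
pose L : pre := [ffun e => if e \in E then \matrix_(i, j) inf (X e i j) else 0].
have L_close v r : covers v r -> forall e i j, `|(L - v) e i j| <= h r.
  move=> vr e i j; rewrite !ffunE; have [eE|eE] := boolP (e \in E); last first.
    by rewrite (supp_eq0 vr.1 eE) subrr mxE normr0 sqrtr_ge0.
  have X_lb v' r' : covers v' r' -> lbound (X e i j) (v' e i j - h r').
    move=> v'r' _ [w [s [ws ->]]].
    have := close _ _ _ _ v'r' ws; have := coord_le_norm2 (v' - w) e i j.
    have := ler_norm ((v' - w) e i j); rewrite !ffunE !mxE; lra.
  have vX : X e i j (v e i j + h r) by exists v, r.
  rewrite !mxE ler_distl; apply/andP; split.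
    by apply: lb_le_inf; [exists (v e i j + h r)|exact: X_lb].
  by apply: ge_inf => //; exists (v e i j - h r); exact: X_lb.
exists L; split.
  apply/fintype.subsetP => e; rewrite inE ffunE; by case: ifP; rewrite ?eqxx.
move=> a Aa; apply/ler_addgt0Pr => e e0.
pose K := l2norm (fun _ : edge t * ('I_n * 'I_d) => 1 : R).
have K0 : 0 <= K by exact: sqrtr_ge0.
pose c := e / (2 * (K + 1)); have c0 : 0 < c by rewrite divr_gt0 // mulr_gt0 // ltr_wpDl.
have cK : c * K <= e / 2.
  rewrite /c mulrAC ler_pdivrMr ?mulr_gt0 ?ltr_wpDl //.
  have -> : e / 2 * (2 * (K + 1)) = e * K + e by field.
  by rewrite lerDl ltW.
(* For [r < r0 + eta], the square of [h r] is [2 * (r - r0) * (r + r0)], at most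
   [eta * (2 * (2 * r0 + 1))], hence at most [c ^+ 2]. The error [e] is shared between [h r * K] and
   [r - r0]. *)
pose eta := Num.min (e / 2) (Num.min 1 (c ^+ 2 / (2 * (2 * r0 + 1)))).
have den0 : 0 < 2 * (2 * r0 + 1) by rewrite mulr_gt0 // ltr_wpDl // mulr_ge0.
have eta0 : 0 < eta by rewrite !lt_min ?divr_gt0 ?exprn_gt0 ?ltr01.
have [eta1 eta2 eta3] : [/\ eta <= e / 2, eta <= 1 & eta <= c ^+ 2 / (2 * (2 * r0 + 1))].
  by rewrite !ge_min !lexx !orbT.
have [v [r [vr rr0]]] := r0_inf eta eta0.
have r0r := r0_le vr.
have hc : h r <= c.
  rewrite /h -(ger0_norm (ltW c0)) -sqrtr_sqr ler_wsqrtr //.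
  move: eta3; rewrite ler_pdivlMr //; apply: le_trans.
  have -> : 2 * (r ^+ 2 - r0 ^+ 2) = (r - r0) * (2 * (r + r0)) by ring.
  have r_ge0 : 0 <= r := le_trans r0_ge0 r0r.
  apply: ler_pM; [by rewrite subr_ge0|by rewrite mulr_ge0 // addr_ge0| |].
    by rewrite lerBlDl ltW.
  rewrite ler_pM2l // mulr_natl mulr2n addrAC lerD2r.
  by apply: le_trans (ltW rr0) _; rewrite lerD2l.
apply: le_trans (snorm_triangle HN v _ _) _.
have := norm2_le_coord (L_close v r vr); have := vr.2 a Aa.
have : h r * K <= c * K by rewrite ler_wpM2r.
rewrite -/K; lra.
Qed.

End Circumradius.

(** * Means, centroids and circumcenters inside one Euclidean chart *)

Section ChartAverages.

Variables (R : realType) (d n : nat) (t : btree).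
Local Notation pre := {ffun edge t -> 'M[R]_(n, d)}.
Local Notation N := (@norm2 R d n t).
Let HN : shape_norm N := @shape_norm2 R d n t.

Lemma supp_sum (T : Type) (E : {set edge t}) (s : seq T) (a : T -> pre) :
  (forall y, supp (a y) \subset E) -> supp (\sum_(y <- s) a y) \subset E.
Proof.
move=> aE; apply/fintype.subsetP => e; rewrite inE; apply: contraR => eE.
by rewrite sum_ffunE big1 // => y _; exact: supp_eq0 (aE y) eE.
Qed.

Lemma supp_scale (E : {set edge t}) (k : R) (v : pre) :
  supp v \subset E -> supp (k *: v) \subset E.
Proof.
move=> vE; apply/fintype.subsetP => e; rewrite inE; apply: contraR => eE.
by rewrite ffunE (supp_eq0 vE eE) scaler0.
Qed.

Definition average (T : Type) (s : seq T) (a : T -> pre) : pre :=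
  (size s)%:R^-1 *: \sum_(y <- s) a y.

Lemma averageE (T : Type) (s : seq T) (a : T -> pre) : (0 < size s)%N ->
  (size s)%:R *: average s a = \sum_(y <- s) a y.
Proof. by move=> s0; rewrite /average scalerA divff ?scale1r // pnatr_eq0 -lt0n. Qed.

Lemma average_ball (T : eqType) (s : seq T) (a : T -> pre) (x : pre) (c : R) :
  (0 < size s)%N -> {in s, forall y, N (a y - x) < c} -> N (average s a - x) < c.
Proof.
move=> s0 ac; have k0 : 0 < (size s)%:R :> R by rewrite ltr0n.
rewrite -(ltr_pM2l k0) -[X in X * N _]ger0_norm ?ltW // -(snormZ HN).
rewrite scalerBr averageE // scaler_nat.
have -> : \sum_(y <- s) a y - x *+ size s = \sum_(y <- s) (a y - x).
  by rewrite sumrB big_const_seq count_predT iter_addr_0.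
case: s s0 ac {k0} => // y s _ ac.
(* The empty sum only allows a weak inequality; strictness comes from the head [y] split off
   above. *)
have le_sum (u : seq T) : {in u, forall y, N (a y - x) < c} ->
    N (\sum_(y <- u) (a y - x)) <= (size u)%:R * c.
  elim: u => [|z u IH] uc; first by rewrite big_nil (snorm0 HN) mul0r.
  rewrite big_cons /= mulrSr mulrDl mul1r [leRHS]addrC.
  apply: le_trans (snormD HN _ _) (lerD _ _).
    by apply/ltW/uc; rewrite inE eqxx.
  by apply: IH => w wu; apply: uc; rewrite inE wu orbT.
rewrite big_cons /= mulrSr mulrDl mul1r; apply: le_lt_trans (snormD HN _ _) _.
rewrite addrC; apply: ler_ltD; last by apply: ac; rewrite inE eqxx.
by apply: le_sum => w ws; apply: ac; rewrite inE ws orbT.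
Qed.

Lemma segment_ball (x v w : pre) (u c : R) : u \in `[0, 1] ->
  N (v - x) < c -> N (w - x) < c -> N (segment v w u - x) < c.
Proof.
rewrite in_itv /= => /andP[u0 u1] vc wc.
have -> : segment v w u - x = (1 - u) *: (v - x) + u *: (w - x).
  apply/ffunP => e; apply/matrixP => i j; rewrite !ffunE !mxE; ring.
apply: le_lt_trans (snormD HN _ _) _; rewrite !(snormZ HN) !ger0_norm ?subr_ge0 //.
have [->|un0] := eqVneq u 0; first by rewrite subr0 mul1r mul0r addr0.
have u_gt0 : 0 < u by rewrite lt_neqAle eq_sym un0.
have -> : c = (1 - u) * c + u * c by ring.
by apply: ler_ltD; [rewrite ler_wpM2l ?subr_ge0 // ltW|rewrite ltr_pM2l].
Qed.

Variables (T : choiceType) (E : {set edge t}) (f : pre -> T) (D : set T).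
Variables (rho : T -> T -> R) (x : pre) (r : R).
Hypothesis f_chart : chart N E f D rho x r.
Hypothesis rhoC : forall a b, D a -> D b -> rho a b = rho b a.
Hypothesis rho_triangle :
  forall a b c, D a -> D b -> D c -> rho a c <= rho a b + rho b c.

Let B (c : R) (v : pre) := supp v \subset E /\ N (v - x) < c.

Lemma chart_dist v w : B r v -> B r w -> rho (f v) (f w) = N (v - w).
Proof. by case: f_chart => _ _ _ H _ [? ?] [? ?]; exact: H. Qed.

Lemma chart_D v : B r v -> D (f v).
Proof. by case: f_chart => _ _ H _ _ [? ?]; exact: H. Qed.

Lemma chart_inj v w : B r v -> B r w -> f v = f w -> v = w.
Proof.
move=> vr wr vw; have := chart_dist vr wr.
rewrite vw (chart_dist wr wr) subrr (snorm0 HN) => /esym/(snorm_eq0 HN)/eqP.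
by rewrite subr_eq0 => /eqP.
Qed.

Lemma chart_r_gt0 : 0 < r. Proof. by case: f_chart. Qed.

Lemma chart_center c : 0 < c -> B c x.
Proof. by case: f_chart => xE _ _ _ _ c0; split; rewrite ?subrr ?(snorm0 HN). Qed.

Lemma chart_ball c b : c <= r -> D b -> rho (f x) b < c -> exists2 v, B c v & b = f v.
Proof.
move=> cr Db xb; have [_ _ _ _ onto] := f_chart.
have [v vE [bE vr]] := onto b Db (lt_le_trans xb cr); exists v => //.
split=> //; rewrite (snormB HN) -(chart_dist (chart_center chart_r_gt0)) -?bE //.
Qed.

Lemma B_le c c' v : c <= c' -> B c v -> B c' v.
Proof. by move=> cc' [vE vc]; split=> //; exact: lt_le_trans cc'. Qed.

Lemma chart_near c c' v b : c <= r -> c + c' <= r -> B c v -> D b ->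
  rho (f v) b < c' -> exists2 w, B (c + c') w & b = f w.
Proof.
move=> cr ccr vc Db vb; have vr := B_le cr vc.
apply: chart_ball => //; have xr := chart_center chart_r_gt0.
apply: le_lt_trans (rho_triangle (chart_D xr) (chart_D vr) Db) _.
by rewrite chart_dist // (snormB HN) ltrD // vc.2.
Qed.

Lemma chart_segment c v w (u : R) : u \in `[0, 1] -> B c v -> B c w ->
  B c (segment v w u).
Proof.
by move=> u01 [vE vc] [wE wc]; split; [exact: supp_segment|exact: segment_ball].
Qed.

(** The inverse of the chart. The default value [x] keeps [psi] inside the ball for every
    argument. *)
Let psi b : pre := xget x [set v | B r v /\ b = f v].

Lemma psi_B b : B r (psi b).
Proof.
rewrite /psi; case: xgetP => [v _ []//|_]; exact: chart_center chart_r_gt0.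
Qed.

Lemma psiK v : B r v -> psi (f v) = v.
Proof.
move=> vr; have [|pr fv] := @xgetPex _ x [set w | B r w /\ f v = f w].
  by exists v.
by apply: chart_inj.
Qed.

(** Data are taken within [c] of the center; the arguments below follow points up to [4 * c] from
    it, still inside the chart. *)
Let c := r / 8.

Lemma c_gt0 : 0 < c. Proof. by rewrite divr_gt0 ?chart_r_gt0. Qed.

Lemma c_leq k : (k <= 8)%N -> k%:R * c <= r.
Proof.
move=> k8; rewrite /c mulrA ler_pdivrMr // mulrC ler_wpM2l ?ler_nat //.
exact/ltW/chart_r_gt0.
Qed.

Lemma c_le : c <= r. Proof. by have := @c_leq 1 isT; rewrite mul1r. Qed.

Let U := mball D rho (f x) c.

Lemma psi_U y : U y -> B c (psi y) /\ f (psi y) = y.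
Proof.
by move=> [Dy /(chart_ball c_le Dy)[v vc ->]]; rewrite psiK //; exact: B_le c_le vc.
Qed.

(** A point closer than [3 * c] to a datum is within [4 * c] of the center, hence in the chart. *)
Lemma far_from_U m y : D m -> ~ (exists2 v, B r v & m = f v) -> U y ->
  3 * c <= rho m y.
Proof.
move=> Dm far Uy; rewrite leNgt; apply/negP => my; apply: far.
have [yc yE] := psi_U Uy; have := @chart_near c (3 * c) (psi y) m c_le.
rewrite yE; case=> //; first by have := @c_leq 4 isT; lra.
  by rewrite rhoC //; case: Uy.
by move=> v vc ->; exists v => //; apply: B_le vc; have := @c_leq 4 isT; lra.
Qed.

(** Inside the chart [sum_sqr_norm2] singles out the average. Outside, every datum is at distance at
    least [3 * c], whereas the center [x] already achieves distances below [c]. *)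
Lemma chart_mean (S : set T) : S `<=` U -> finite_set S -> S !=set0 ->
  exists! m, is_mean D rho S m.
Proof.
move=> SU Sfin [y0 Sy0]; pose s : seq T := finmap.enum_fset (fset_set S).
have sE y : (y \in s) = (y \in S) := in_fset_set Sfin y.
have sS y : y \in s -> S y by rewrite sE inE.
have s0 : (0 < size s)%N.
  by rewrite -has_predT; apply/hasP; exists y0 => //; rewrite sE inE.
have k0 : 0 < (size s)%:R :> R by rewrite ltr0n.
pose mu := average s psi.
have muc : B c mu.
  split; first by apply/supp_scale/supp_sum => y; exact: (psi_B y).1.
  by apply: average_ball => // y /sS/SU/psi_U[[]].
have mur := B_le c_le muc.
pose V := \sum_(y <- s) N (mu - psi y) ^+ 2.
have sumE v : B r v ->
    \sum_(y \in S) rho (f v) y ^+ 2 = (size s)%:R * N (v - mu) ^+ 2 + V.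
  move=> vr; rewrite (fsbig_finite _ _ Sfin) /= -(sum_sqr_norm2 _ (averageE _ s0)).
  rewrite big_seq [RHS]big_seq; apply: eq_bigr => y /sS/SU/psi_U[yc yE].
  by rewrite -{1}yE chart_dist //; exact: B_le c_le yc.
have V_le : V <= (size s)%:R * c ^+ 2.
  apply: le_trans (_ : \sum_(y <- s) N (x - psi y) ^+ 2 <= _).
    rewrite (sum_sqr_norm2 x (averageE psi s0)) lerDr mulr_ge0 ?sqr_ge0 //.
  rewrite mulr_natl -[leRHS]addr0 -iter_addr -count_predT -big_const_seq.
  rewrite big_seq [leRHS]big_seq; apply: ler_sum => y /sS/SU/psi_U[[_ yc] _].
  by rewrite lerXn2r ?nnegrE ?(snorm_ge0 HN) ?ltW ?c_gt0 // (snormB HN).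
have sum_far m : D m -> ~ (exists2 v, B r v & m = f v) ->
    V < \sum_(y \in S) rho m y ^+ 2.
  move=> Dm far; apply: le_lt_trans V_le _.
  rewrite (fsbig_finite _ _ Sfin) /=.
  apply: lt_le_trans (_ : \sum_(y <- s) (3 * c) ^+ 2 <= _).
    rewrite big_const_seq count_predT iter_addr_0 -[ltRHS]mulr_natl ltr_pM2l //.
    have c2 : 0 < c ^+ 2 := exprn_gt0 _ c_gt0.
    by rewrite (_ : (3 * c) ^+ 2 = 9 * c ^+ 2); [lra|ring].
  rewrite big_seq [leRHS]big_seq; apply: ler_sum => y /sS/SU Uy.
  have := far_from_U Dm far Uy => cy; rewrite lerXn2r ?nnegrE //.
    by rewrite mulr_ge0 // ltW // c_gt0.
  by apply: le_trans cy; rewrite mulr_ge0 // ltW // c_gt0.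
have sum_mu : \sum_(y \in S) rho (f mu) y ^+ 2 = V.
  by rewrite (sumE _ mur) subrr (snorm0 HN) expr0n /= mulr0 add0r.
exists (f mu); split; first split; first exact: chart_D.
  move=> m Dm; rewrite sum_mu.
  have [[v vr ->]|/(sum_far m Dm)/ltW//] := EM (exists2 v, B r v & m = f v).
  by rewrite (sumE _ vr) lerDr mulr_ge0 ?sqr_ge0 // ltW.
move=> m [Dm mmin]; have := mmin _ (chart_D mur); rewrite sum_mu.
have [[v vr ->]|/(sum_far m Dm)] := EM (exists2 v, B r v & m = f v); last first.
  by rewrite ltNge => /negP.
rewrite (sumE _ vr) gerDr (pmulr_rle0 _ k0) => v0.
have : N (v - mu) ^+ 2 == 0 by rewrite eq_le v0 sqr_ge0.
by rewrite sqrf_eq0 => /eqP/(snorm_eq0 HN)/eqP; rewrite subr_eq0 => /eqP ->.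
Qed.

(** The center [x] covers the data with radius [c], so competitors off the chart, at least [3 * c]
    from the data, lose. Inside, [covers_close] with both radii minimal gives uniqueness. *)
Lemma chart_circumcenter (S : set T) : S `<=` U -> S !=set0 ->
  exists! z, is_circumcenter D rho S z.
Proof.
move=> SU [y0 Sy0]; pose A := psi @` S.
have A0 : A !=set0 by exists (psi y0), y0.
have x_covers a : A a -> N (x - a) <= c.
  by move=> [y /SU/psi_U[[_ /ltW yc] _] <-]; rewrite (snormB HN).
have xE : supp x \subset E by case: f_chart.
have Abd : exists v q, supp v \subset E /\ forall a, A a -> N (v - a) <= q.
  by exists x, c.
have [q [q0 [q_le q_inf]]] := circumradius_exists A0 Abd.
have [z [zE zq]] := covers_min A0 q0 q_le q_inf.
have qc : q <= c by apply: (q_le x).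
have covers_near v s : supp v \subset E -> (forall a, A a -> N (v - a) <= s) ->
    s <= c -> B r v.
  move=> vE vs sc; split=> //; have [a Aa] := A0.
  have := snorm_triangle HN a v x; have := vs a Aa; have := x_covers a Aa.
  by have := @c_leq 3 isT; have := c_gt0; rewrite (snormB HN x); lra.
have zr : B r z := covers_near z q zE zq qc.
have rho_N v y : B r v -> S y -> rho (f v) y = N (v - psi y).
  by move=> vr /SU/psi_U[yc yE]; rewrite -{1}yE chart_dist //; exact: B_le c_le yc.
have small_radius m s : D m -> (forall y, S y -> rho m y <= s) -> s <= c ->
    exists2 v, B r v /\ m = f v & forall a, A a -> N (v - a) <= s.
  move=> Dm ms sc; have [[v vr mE]|far] := EM (exists2 v, B r v & m = f v).
    by exists v => // _ [y Sy <-]; rewrite -rho_N // -mE; exact: ms.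
  by have := far_from_U Dm far (SU _ Sy0); have := ms _ Sy0; have := c_gt0; lra.
have zS y : S y -> rho (f z) y <= q by move=> Sy; rewrite rho_N //; apply: zq; exists y.
exists (f z); split.
  split; first exact: chart_D.
  exists q; split=> // m s Dm ms; have [sc|/ltW cs] := leP s c; last exact: le_trans cs.
  have [v [vr _] vs] := small_radius m s Dm ms sc.
  by apply: (q_le v); split=> //; exact: vr.1.
move=> m [Dm [s [ms smin]]]; have sq : s <= q by apply: smin zS; exact: chart_D.
have [v [vr ->] vs] := small_radius m s Dm ms (le_trans sq qc).
have qs : q <= s by apply: (q_le v); split=> //; exact: vr.1.
have sqE : s = q by apply/eqP; rewrite eq_le sq qs.
congr f; apply/eqP; rewrite -subr_eq0; apply/eqP/(snorm_eq0 HN)/eqP.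
rewrite -sqrf_eq0 eq_le sqr_ge0 andbT.
have := covers_close A0 q0 q_le (conj zE zq) (conj vr.1 vs).
by rewrite sqE subrr mulr0 addr0.
Qed.

(** A geodesic cannot take a detour outside the chart: its points stay within [N (v - w) < 2 * c] of
    [f v]. *)
Lemma chart_geodesic v w : B c v -> B c w ->
  geodesic D rho (f v) (f w) (fun u => f (segment v w u)) /\
  forall h, geodesic D rho (f v) (f w) h ->
    forall u : R, u \in `[0, 1] -> h u = f (segment v w u).
Proof.
move=> vc wc; have vr := B_le c_le vc; have wr := B_le c_le wc.
have seg_r (u : R) : u \in `[0, 1] -> B r (segment v w u).
  by move=> u01; exact: chart_segment.
split.
  split; [by rewrite /segment scale0r addr0|by rewrite /segment scale1r addrC subrK| |].
    by move=> u /seg_r; exact: chart_D.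
  by move=> u u' /seg_r ur /seg_r ur'; rewrite !chart_dist // segmentB.
move=> h [h0 h1 hD hdist] u u01.
have i0 : (0 : R) \in `[0, 1] by rewrite in_itv /= lexx ler01.
have i1 : (1 : R) \in `[0, 1] by rewrite in_itv /= lexx ler01.
have [u0 u1] : 0 <= u /\ u <= 1 by move: u01; rewrite in_itv /= => /andP[].
have vw : N (v - w) < 2 * c.
  have := snorm_triangle HN x v w; rewrite (snormB HN x w).
  by have := vc.2; have := wc.2; lra.
have := hdist 0 u i0 u01; have := hdist u 1 u01 i1; rewrite h0 h1 chart_dist //.
rewrite sub0r normrN (ger0_norm u0) (distrC u 1) ger0_norm ?subr_ge0 // => hu1 hu0.
have [||z zc zE] := @chart_near c (2 * c) v (h u) c_le _ vc (hD u u01).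
- by have := @c_leq 3 isT; lra.
- by rewrite hu0; apply: le_lt_trans vw; rewrite ler_piMl ?(snorm_ge0 HN).
have zr : B r z by apply: B_le zc; have := @c_leq 3 isT; lra.
rewrite zE chart_dist // in hu0; rewrite zE chart_dist // in hu1.
rewrite zE; congr f; apply/eqP; rewrite -subr_eq0; apply/eqP/(snorm_eq0 HN)/eqP.
(* With distances [u * L] and [(1 - u) * L] to the ends of a segment of length [L], Stewart's right
   side vanishes. *)
rewrite -sqrf_eq0 stewart (snormB HN z v) hu0 hu1; apply/eqP; ring.
Qed.

Lemma average_ordE m (v : 'I_m.+1 -> pre) :
  m.+1%:R *: average (enum 'I_m.+1) v = \sum_(i < m.+1) v i.
Proof.
have := @averageE _ (enum 'I_m.+1) v; rewrite size_enum_ord => -> //.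
by rewrite big_enum.
Qed.

(* Replacing each member of a family of [m] vectors by the average of the others
   multiplies the deviations from the average by [- 1 / (m - 1)]. *)
Lemma average_lift k (v : 'I_k.+3 -> pre) (i : 'I_k.+3) (mu := average (enum 'I_k.+3) v) :
  average (enum 'I_k.+2) (fun h => v (lift i h)) =
  mu - k.+2%:R^-1 *: (v i - mu).
Proof.
have k2 : k.+2%:R != 0 :> R by rewrite pnatr_eq0.
apply: (scalerI k2); rewrite average_ordE.
rewrite scalerBr (scalerA _ _ (v i - mu)) divff // (scale1r (v i - mu)) opprB addrA.
rewrite -[X in _ + X - _]scale1r -scalerDl -mulrSr average_ordE.
by rewrite [in RHS](bigD1_ord i) //= addrAC subrr add0r.
Qed.

Lemma average_ord_B k (v : 'I_k.+1 -> pre) : (forall i, B c (v i)) ->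
  B c (average (enum 'I_k.+1) v).
Proof.
move=> vc; split; first by apply/supp_scale/supp_sum => i; exact: (vc i).1.
by apply: average_ball => [|i _]; [rewrite size_enum_ord|exact: (vc i).2].
Qed.

(** By [average_lift] the iterated families keep the average [mu] and shrink geometrically towards
    it, with ratio [q] in absolute value; convexity keeps them in the small ball. *)
Lemma chart_family_centroid k (F : 'I_k.+2 -> T) (v : 'I_k.+2 -> pre) b :
  (forall i, B c (v i)) -> (forall i, F i = f (v i)) ->
  family_centroid D rho F b <-> b = f (average (enum 'I_k.+2) v).
Proof.
elim: k F v b => [|k IH] F v b vc Fv.
  have [geo geo_uniq] := chart_geodesic (vc ord0) (vc ord_max).
  have half : (2^-1 : R) \in `[0, 1].
    by rewrite in_itv /= invr_ge0 ler0n invf_le1 // ler1n.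
  have -> : average (enum 'I_2) v = segment (v ord0) (v ord_max) 2^-1.
    have two : (2 : R) != 0 by rewrite pnatr_eq0.
    apply: (scalerI two); rewrite average_ordE !big_ord_recl big_ord0 addr0.
    have -> : lift ord0 ord0 = ord_max :> 'I_2 by exact/val_inj.
    rewrite /segment scalerDr scalerA divff // scale1r.
    by rewrite scaler_nat mulr2n -addrA [v ord0 + (_ - _)]addrC subrK.
  rewrite /= /unique_geodesic_midpoint !Fv; split=> [[g [gG _ <-]]|->].
    exact: geo_uniq.
  by exists (fun u => f (segment (v ord0) (v ord_max) u)).
have [mu muE] : exists mu, average (enum 'I_k.+3) v = mu by eexists.
have mu_sum : k.+3%:R *: mu = \sum_i v i by rewrite -muE average_ordE.
rewrite muE; pose q : R := k.+2%:R^-1.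
have muc : B c mu by rewrite -muE; exact: average_ord_B.
have mur := B_le c_le muc.
(* The closed form of the [j]-th family, the sign alternating at each stage. *)
pose w j i : pre := mu + (- q) ^+ j *: (v i - mu).
have w0 i : w 0%N i = v i by rewrite /w expr0 scale1r addrC subrK.
have w_avg j : average (enum 'I_k.+3) (w j) = mu.
  have k3 : k.+3%:R != 0 :> R by rewrite pnatr_eq0.
  apply: (scalerI k3); rewrite average_ordE /w big_split /= -scaler_sumr.
  rewrite sumrB -mu_sum !sumr_const !card_ord -scaler_nat.
  by rewrite subrr scaler0 addr0.
have w_lift j (i : 'I_k.+3) : average (enum 'I_k.+2) (fun h => w j (lift i h)) = w j.+1 i.
  rewrite average_lift w_avg /w addrAC subrr add0r scalerA exprS mulNr scaleNr.
  by [].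
have wc j i : B c (w j i).
  elim: j i => [|j IHj] i; first by rewrite w0.
  by rewrite -w_lift; apply: average_ord_B => h.
have wr j i : B r (w j i) := B_le c_le (wc j i).
have w_cvg i : rho (f (w j i)) (f mu) @[j --> \oo] --> (0 : R).
  have -> : (fun j => rho (f (w j i)) (f mu)) = (fun j => N (v i - mu) * q ^+ j).
    apply/funext => j; rewrite chart_dist // /w addrAC subrr add0r (snormZ HN).
    rewrite normrX normrN ger0_norm ?invr_ge0 ?ler0n // mulrC //.
  rewrite -[X in _ --> X](mulr0 (N (v i - mu))); apply: cvgMr.
  apply: cvg_expr; rewrite ger0_norm ?invr_ge0 ?ler0n //.
  by rewrite invf_lt1 ?ltr0n // ltr1n.
split=> [[Db [C [C0 C_centroid C_cvg]]]|->].
  have Cw j i : C j i = f (w j i).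
    elim: j i => [|j IHj] i; first by rewrite C0 w0.
    rewrite -w_lift.
    exact: ((IH _ (fun h => w j (lift i h)) _ (fun h => wc j _)
      (fun h => IHj _)).1 (C_centroid j i)).
  have : rho (f mu) b <= 0 + 0.
    have cv : rho (f (w j ord0)) (f mu) + rho (C j ord0) b @[j --> \oo] --> (0 + 0 : R).
      exact: cvgD (w_cvg ord0) (C_cvg ord0).
    apply: cvgr_to_ge cv _; apply: nearW => j; rewrite Cw (rhoC (chart_D (wr j _)) (chart_D mur)).
    by apply: rho_triangle => //; exact: chart_D.
  rewrite addr0 => mub.
  (* Distance 0 separates points only inside the chart, so [b] must first be located there. *)
  have [||u uc bE] := @chart_near c c mu b c_le _ muc Db.
  - by have := @c_leq 2 isT; lra.
  - exact: le_lt_trans mub c_gt0.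
  have ur : B r u by apply: B_le uc; have := @c_leq 2 isT; lra.
  move: mub; rewrite bE chart_dist // => muu; congr f; apply/esym/eqP.
  rewrite -subr_eq0; apply/eqP/(snorm_eq0 HN)/eqP.
  by rewrite eq_le muu (snorm_ge0 HN).
split; first exact: chart_D.
exists (fun j i => f (w j i)); split.
- by apply/funext => i; rewrite w0 Fv.
- move=> j i; rewrite -w_lift.
  exact: ((IH _ (fun h => w j (lift i h)) _ (fun h => wc j _)
    (fun h => erefl)).2 erefl).
- by move=> i; exact: w_cvg.
Qed.

(** Any injective enumeration of [S] may be used in [is_centroid]; all lead to the same average,
    which is independent of the order. *)
Lemma chart_centroid (S : set T) : S `<=` U -> finite_set S ->
  (exists a b, [/\ S a, S b & a <> b]) -> exists! z, is_centroid D rho S z.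
Proof.
move=> SU Sfin [a [b [Sa Sb ab]]].
pose s : seq T := finmap.enum_fset (fset_set S).
have sE y : (y \in s) = (y \in S) := in_fset_set Sfin y.
have s_uniq : uniq s := finmap.fset_uniq _.
have size_s : (1 < size s)%N.
  rewrite ltnNge; apply/negP => s1; apply: ab.
  have : a \in s by rewrite sE inE.
  have : b \in s by rewrite sE inE.
  by case: s s1 {sE s_uniq} => [|y []] // _; rewrite !inE => /eqP -> /eqP ->.
have centroidP k (F : 'I_k.+2 -> T) : injective F -> S = range F ->
    forall z, family_centroid D rho F z <-> z = f (average s psi).
  move=> F_inj FS z.
  have Fs : perm_eq [seq F i | i <- enum 'I_k.+2] s.
    apply: uniq_perm => [|//|y].
      by rewrite map_inj_uniq //; exact: (enum_uniq 'I_k.+2).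
    rewrite sE; apply/mapP/idP => [[i _ ->]|]; rewrite inE FS.
      by exists i.
    by move=> [i _ <-]; exists i; rewrite ?mem_enum.
  have FU i : U (F i) by apply: SU; rewrite FS; exists i.
  have -> : average s psi = average (enum 'I_k.+2) (psi \o F).
    rewrite /average -(perm_size Fs) size_map; congr (_ *: _).
    by rewrite -(perm_big _ Fs) big_map.
  by apply: chart_family_centroid => i /=; have [] := psi_U (FU i).
pose k := (size s).-2; have sk : size s = k.+2.
  by rewrite /k; case: (size s) size_s => [|[]].
pose F (i : 'I_k.+2) := nth a s i.
have F_inj : injective F.
  move=> i j /eqP; rewrite nth_uniq ?sk ?ltn_ord // => /eqP ij; exact: val_inj.
have FS : S = range F.
  apply/seteqP; split=> [y Sy|_ [i _ <-]].
    have ys : y \in s by rewrite sE inE.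
    have ysk : (index y s < k.+2)%N by rewrite -sk index_mem.
    by exists (Ordinal ysk) => //; rewrite /F /= nth_index.
  have : F i \in s by rewrite mem_nth ?sk.
  by rewrite sE inE.
exists (f (average s psi)); split.
  by exists k, F; split=> //; exact/centroidP.
by move=> z [k' [F' [F'_inj F'S /(centroidP k' F' F'_inj F'S) ->]]].
Qed.

Lemma chart_unique_averages : exists2 V, mnbhs D rho (f x) V & unique_averages_in D rho V.
Proof.
exists U; first by split=> [y []//|]; exists c; [exact: c_gt0|].
split=> [S SU Sfin S0|S SU Sfin Sab|S SU _ S0].
- exact: chart_mean.
- exact: chart_centroid.
- exact: chart_circumcenter.
Qed.

End ChartAverages.

(** * Averages in taxicab charts *)

Section TaxicabAverages.

(** Any metric midpoint qualifies. For every [y] the distances to [a] and [b] add up to at least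
    [rho a b], so their squares and their maximum are smallest when both are half of it. *)
Lemma two_point_mean (R : realType) (T : choiceType) (D : set T)
    (rho : T -> T -> R) (a b m : T) :
  (forall u v, D u -> D v -> rho u v = rho v u) ->
  (forall u v w, D u -> D v -> D w -> rho u w <= rho u v + rho v w) ->
  D a -> D b -> D m -> a <> b -> 0 <= rho a b ->
  rho m a = rho a b / 2 -> rho m b = rho a b / 2 ->
  is_mean D rho [set a; b] m /\ is_circumcenter D rho [set a; b] m.
Proof.
move=> rhoC tri Da Db Dm ab ab0 ma mb.
have half_le y : D y -> rho a b <= rho y a + rho y b.
  by move=> Dy; rewrite (rhoC y a) //; exact: tri.
split; split=> //.
  move=> y Dy; have sumE (z : T) :
      \sum_(w \in [set a; b]) rho z w ^+ 2 = rho z a ^+ 2 + rho z b ^+ 2.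
    rewrite fsbigU0 ?fsbig_set1 //.
    by move=> w [-> /=].
  rewrite !sumE ma mb; have := half_le y Dy.
  move: (rho y a) (rho y b) (rho a b) ab0 => p q l l0 lpq.
  have := sqr_ge0 (p - q).
  have : l ^+ 2 <= (p + q) ^+ 2 by rewrite lerXn2r ?nnegrE // (le_trans l0).
  rewrite !exprMn !exprVn sqrrD sqrrB; lra.
exists (rho a b / 2); split=> [_ [->|->]|z s Dz zs]; rewrite ?ma ?mb //.
have := half_le z Dz; have := zs a (or_introl erefl); have := zs b (or_intror erefl).
lra.
Qed.

(** The path along two sides of the unit square, through the corner (1, 0) at time 1/2. Both
    coordinates are nondecreasing with sum [2 * u], so the l1 speed is constant. *)
Lemma staircase (R : realType) : exists k l : R -> R,
  [/\ forall u, 0 <= u <= 1 -> 0 <= k u <= 1 /\ 0 <= l u <= 1,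
      forall u v, `|k u - k v| + `|l u - l v| = 2 * `|u - v|,
      k 0 = 0 /\ l 0 = 0, k 1 = 1 /\ l 1 = 1 & k 2^-1 = 1 /\ l 2^-1 = 0].
Proof.
pose k (u : R) := Num.min (2 * u) 1; pose l (u : R) := Num.max (2 * u - 1) 0.
have kl u : k u + l u = 2 * u.
  rewrite /k /l; case: (lerP (2 * u) 1) => u1'.
    by rewrite max_r ?addr0 // subr_le0.
  by rewrite max_l ?subr_ge0 ?ltW // addrC subrK.
exists k, l; split.
- move=> u /andP[u0 u1]; rewrite /k /l le_min ge_min le_max ge_max lexx !orbT /=.
  by rewrite ler01 lexx mulr_ge0 //= !andbT; split=> //; lra.
- move=> u v; wlog uv : u v / u <= v => [H|].
    case: (leP u v) => [/H//|/ltW/H]; rewrite distrC (distrC (l v)) (distrC v) //.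
  have uv2 : 2 * u <= 2 * v by rewrite ler_pM2l.
  have kuv : k u <= k v by rewrite /k le_min !ge_min uv2 lexx orbT.
  have luv : l u <= l v by rewrite /l ge_max !le_max lerD2r uv2 lexx orbT.
  rewrite !ler0_norm ?subr_le0 //; have := kl u; have := kl v; lra.
- by rewrite /k /l mulr0 sub0r min_l // max_r // oppr_le0.
- by rewrite /k /l mulr1 min_r ?max_l; lra.
- by rewrite /k /l divff // subrr minxx maxxx.
Qed.

Variables (R : realType) (d n : nat) (t : btree).
Local Notation pre := {ffun edge t -> 'M[R]_(n, d)}.
Local Notation N := (@norm1 R d n t).
Let HN : shape_norm N := @shape_norm1 R d n t.

(* In the l1-plane spanned by two edges, the midpoint of the diagonal of a square
   and another vertex of the square are both midpoints of the diagonal. *)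
Lemma chart_averages_not_unique (hd : (0 < d)%N) (hn : (0 < n)%N) (T : choiceType)
    (E : {set edge t}) (f : pre -> T) (D : set T) (rho : T -> T -> R) x r :
  (1 < #|E|)%N -> chart N E f D rho x r ->
  (forall a b, D a -> D b -> rho a b = rho b a) ->
  (forall a b c, D a -> D b -> D c -> rho a c <= rho a b + rho b c) ->
  averages_not_unique D rho.
Proof.
move=> /card_gt1P[e1 [e2 [e1E e2E e12]]] [xE r0 fD f_iso _] rhoC tri.
pose M1 : 'M[R]_(n, d) := const_mx 1.
have M10 : 0 < enorm M1.
  rewrite enorm_gt0; apply/eqP => /(congr1 (fun M : 'M[R]_(n, d) => M (Ordinal hn) (Ordinal hd))).
  by rewrite !mxE => /eqP; rewrite oner_eq0.
(* The l1 diameter [2 * c] of a square of side [c] at [x] must stay below [r]. *)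
pose c := r / 4; have c0 : 0 < c by rewrite divr_gt0.
have [M Mc] : exists M : 'M[R]_(n, d), enorm M = c.
  exists ((c / enorm M1) *: M1).
  by rewrite enormZ ger0_norm ?divr_ge0 ?enorm_ge0 ?ltW // divfK // gt_eqF.
pose u1 : pre := [ffun e => if e == e1 then M else 0].
pose u2 : pre := [ffun e => if e == e2 then M else 0].
have NE (k l : R) : N (k *: u1 + l *: u2) = (`|k| + `|l|) * c.
  rewrite /norm1 (bigD1 e1) //= (bigD1 e2) 1?eq_sym //= big1 ?addr0 => [|e /andP[ee1 ee2]].
    rewrite !ffunE !eqxx (negbTE e12) eq_sym (negbTE e12) !scaler0 addr0 add0r.
    by rewrite !enormZ Mc mulrDl.
  by rewrite !ffunE (negbTE ee1) (negbTE ee2) !scaler0 addr0 enorm0.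
pose P (k l : R) : pre := x + (k *: u1 + l *: u2).
have PB k l k' l' : N (P k l - P k' l') = (`|k - k'| + `|l - l'|) * c.
  rewrite -NE; congr N; rewrite /P opprD addrACA subrr add0r.
  by rewrite opprD addrACA -!scalerBl.
have P00 : P 0 0 = x by rewrite /P !scale0r !addr0.
have PE k l : supp (P k l) \subset E.
  apply/fintype.subsetP => e; rewrite inE; apply: contraR => eE.
  have ee1 : e == e1 = false by apply: contraNF eE => /eqP ->.
  have ee2 : e == e2 = false by apply: contraNF eE => /eqP ->.
  by rewrite !ffunE (supp_eq0 xE eE) ee1 ee2 !scaler0 !addr0.
have Px k l : 0 <= k <= 1 -> 0 <= l <= 1 -> N (P k l - x) < r.
  move=> /andP[k0 k1] /andP[l0 l1]; rewrite -P00 PB !subr0 !ger0_norm //.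
  have : (k + l) * c <= 2 * c by rewrite ler_pM2r //; lra.
  rewrite /c; lra.
have fP k l : 0 <= k <= 1 -> 0 <= l <= 1 -> D (f (P k l)).
  by move=> ? ?; apply: fD => //; exact: Px.
have rhoP k l k' l' : 0 <= k <= 1 -> 0 <= l <= 1 -> 0 <= k' <= 1 -> 0 <= l' <= 1 ->
    rho (f (P k l)) (f (P k' l')) = (`|k - k'| + `|l - l'|) * c.
  by move=> *; rewrite f_iso ?PB //; exact: Px.
have b0 : 0 <= (0 : R) <= 1 by rewrite lexx ler01.
have b1 : 0 <= (1 : R) <= 1 by rewrite lexx ler01.
have b2 : 0 <= (2^-1 : R) <= 1 by apply/andP; split; lra.
have n10 : `|1 - 0 : R| = 1 by rewrite subr0 normr1.
have n01 : `|0 - 1 : R| = 1 by rewrite sub0r normrN normr1.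
have n20 : `|2^-1 - 0 : R| = 2^-1 by rewrite subr0 ger0_norm; lra.
have n21 : `|2^-1 - 1 : R| = 2^-1 by rewrite ler0_norm; lra.
have n00 (k : R) : `|k - k| = 0 by rewrite subrr normr0.
pose a := f (P 0 0); pose b := f (P 1 1).
pose m := f (P 2^-1 2^-1); pose m' := f (P 1 0).
have Da : D a by exact: fP.
have Db : D b by exact: fP.
have Dm : D m by exact: fP.
have Dm' : D m' by exact: fP.
have rab : rho a b = 2 * c by rewrite rhoP // n01; ring.
have rma : rho m a = rho a b / 2 by rewrite rab rhoP // n20; field.
have rmb : rho m b = rho a b / 2 by rewrite rab rhoP // n21; field.
have rm'a : rho m' a = rho a b / 2 by rewrite rab rhoP // n10 n00; field.
have rm'b : rho m' b = rho a b / 2 by rewrite rab rhoP // n01 n00; field.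
have rho_neq u v : rho u v != rho v v -> u <> v by move=> uv uvE; rewrite uvE eqxx in uv.
have raa k l : 0 <= k <= 1 -> 0 <= l <= 1 -> rho (f (P k l)) (f (P k l)) = 0.
  by move=> *; rewrite rhoP // !n00 addr0 mul0r.
have ab : a <> b by apply: rho_neq; rewrite rab raa // gt_eqF // mulr_gt0.
have mm' : m <> m'.
  apply: rho_neq; rewrite raa // rhoP // n20 n21 gt_eqF // mulr_gt0 // addr_gt0 //; lra.
have ab0 : 0 <= rho a b by rewrite rab mulr_ge0 // ltW.
have [m_mean m_cc] := two_point_mean rhoC tri Da Db Dm ab ab0 rma rmb.
have [m'_mean m'_cc] := two_point_mean rhoC tri Da Db Dm' ab ab0 rm'a rm'b.
have m_mid : geodesic_midpoint D rho a b m.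
  exists (fun u => f (P u u)) => //; split=> //.
    by move=> u; rewrite in_itv => u01; exact: fP.
  by move=> u v; rewrite !in_itv => u01 v01; rewrite rab rhoP //; ring.
have m'_mid : geodesic_midpoint D rho a b m'.
  have [k [l [kl01 kl_dist [k0 l0] [k1 l1] [k2 l2]]]] := staircase R.
  exists (fun u => f (P (k u) (l u))); last by rewrite k2 l2.
  split; [by rewrite k0 l0|by rewrite k1 l1| |].
    by move=> u; rewrite in_itv => /kl01[? ?]; exact: fP.
  move=> u v; rewrite !in_itv => /kl01[? ?] /kl01[? ?]; rewrite rab rhoP //.
  by rewrite kl_dist; ring.
by split; exists a, b, m, m'.
Qed.

End TaxicabAverages.

(** * Shape spaces *)

Section QuotientAverages.

Variables (R : realType) (d n : nat) (t : btree).
Local Notation pre := {ffun edge t -> 'M[R]_(n, d)}.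
Hypotheses (hd : (0 < d)%N) (hn : (0 < n)%N).
Variables (Q : choiceType) (p : pre -> Q) (F : {set {set edge t}}).
Let Z : set pre := @rpreshape R d n t F.
Hypothesis p_transport : forall x y, p x = p y ->
  exists2 s, y = reorder_act s x & transports p s x.

(** Holds both for the norm distance on the whole space and for the length metric of a union of
    coordinate subspaces. *)
Definition piecewise_norm (N : pre -> R) (rho : pre -> pre -> R) : Prop :=
  [/\ forall x y, Z x -> Z y -> N (x - y) <= rho x y,
      forall E x y, E \in F -> supp x \subset E -> supp y \subset E ->
        rho x y <= N (x - y)
    & forall x y, Z x -> Z y -> rho x y = rho y x].

Lemma piecewise_norm_length (N : pre -> R) : shape_norm N ->
  piecewise_norm N (length_dist Z (fun x y => N (x - y))).
Proof.
move=> HN; split=> [x y|E x y|x y _ _].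
- exact: length_dist_ge.
- exact: length_dist_le.
- exact: length_distC.
Qed.

Variable rho : pre -> pre -> R.
Let D := p @` Z.

Section PseudoMetric.

Variable N : pre -> R.
Hypotheses (HN : shape_norm N) (Hrho : piecewise_norm N rho).

Lemma piecewise_norm_ge0 x y : Z x -> Z y -> 0 <= rho x y.
Proof.
by case: Hrho => H _ _ Zx Zy; apply: le_trans (snorm_ge0 HN _) (H x y Zx Zy).
Qed.

Lemma piecewise_quot_distC a b : D a -> D b ->
  quot_dist p Z rho a b = quot_dist p Z rho b a.
Proof. by move=> _ _; apply: quot_distC; case: Hrho. Qed.

Lemma piecewise_quot_dist_triangle a b c : D a -> D b -> D c ->
  quot_dist p Z rho a c <= quot_dist p Z rho a b + quot_dist p Z rho b c.
Proof. exact: quot_dist_triangle piecewise_norm_ge0 _ _ _. Qed.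

End PseudoMetric.

Lemma quotient_unique_averages : piecewise_norm (@norm2 R d n t) rho ->
  generically_unique_averages D (quot_dist p Z rho).
Proof.
move=> Hrho; have [rho_ge rho_le rhoC] := Hrho.
have HN := @shape_norm2 R d n t.
apply: (full_chart_generic HN p_transport rho_ge rho_le hd hn) => x r xr.
apply: (chart_unique_averages xr).
- exact: piecewise_quot_distC Hrho.
- exact: piecewise_quot_dist_triangle HN Hrho.
Qed.

(** One chart with two edges suffices: it is found at a perturbation of 0 in the largest allowed
    subspace. *)
Lemma quotient_averages_not_unique : piecewise_norm (@norm1 R d n t) rho ->
  (exists2 E, E \in F & (1 < #|E|)%N) ->
  averages_not_unique D (quot_dist p Z rho).
Proof.
move=> Hrho [E0 E0F E01]; have [rho_ge rho_le rhoC] := Hrho.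
have HN := @shape_norm1 R d n t.
have [E EF Emax] := arg_maxnP (P := mem F) (fun E : {set edge t} => #|E|) E0F.
have [x [xE x_inj _]] : exists z : pre, [/\ supp z = E, {in E &, injective z} &
    norm1 (0 - z) < 1].
  apply: (perturb HN hd hn) => //.
  by apply/fintype.subsetP => e; rewrite inE ffunE eqxx.
have x_full : full_point p F x.
  by apply: full_point_max; rewrite ?xE // => E' y E'F _ _; exact: Emax.
have [r [xr _]] := full_chart HN p_transport rho_ge rho_le x_full.
apply: (chart_averages_not_unique hd hn _ xr).
- by rewrite xE; exact: leq_trans E01 (Emax _ E0F).
- exact: piecewise_quot_distC Hrho.
- exact: piecewise_quot_dist_triangle HN Hrho.
Qed.

End QuotientAverages.

Lemma card_edge_gt1 (t : btree) : (0 < #|edge t|)%N -> (1 < #|edge t|)%N.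
Proof.
case: t => [|l r _] /=; first by rewrite card_void.
by rewrite card_sum !card_option addSn addnS.
Qed.

Section ShapeSpaces.

Variables (R : realType) (d n : nat) (t : btree).
Local Notation pre := {ffun edge t -> 'M[R]_(n, d)}.

Lemma rpreshape_setT : rpreshape R d n [set: {set edge t}]%SET = [set: preshape R d n t].
Proof.
by apply/seteqP; split=> // x _; exists [set: edge t]%SET => [|e]; rewrite !inE.
Qed.

Lemma roshape_setT : roshape R d n [set: {set edge t}]%SET = [set: oshape R d n t].
Proof.
rewrite /roshape rpreshape_setT; apply/seteqP; split=> // a _.
by have [x <-] := oproj_surj a; exists x.
Qed.

Lemma rushape_setT : rushape R d n [set: {set edge t}]%SET = [set: ushape R d n t].
Proof.
rewrite /rushape roshape_setT; apply/seteqP; split=> // a _.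
by elim/quotW: a => a; exists a.
Qed.

Lemma rushapeE (F : {set {set edge t}}) :
  @rushape R d n t F = @shape_proj R d n t @` @rpreshape R d n t F.
Proof. by rewrite /rushape /roshape image_comp. Qed.

Lemma quot_dist_shape_proj (F : {set {set edge t}}) (N : pre -> R)
    (rho : preshape R d n t -> preshape R d n t -> R) :
  shape_norm N -> piecewise_norm F N rho ->
  quot_dist uproj (@roshape R d n t F) (quot_dist oproj (@rpreshape R d n t F) rho) =
  quot_dist (@shape_proj R d n t) (@rpreshape R d n t F) rho.
Proof. by move=> HN Hrho; apply: quot_dist_comp; exact: piecewise_norm_ge0 HN Hrho. Qed.

Lemma piecewise_norm_full (N : pre -> R) : shape_norm N ->
  piecewise_norm [set: {set edge t}]%SET N (fun x y => N (x - y)).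
Proof. by move=> HN; split=> // x y _ _; exact: snormB. Qed.

End ShapeSpaces.

Theorem theorem39 (R : realType) (d n : nat) (t : btree)
    (hd : (0 < d)%N) (hn : (0 < n)%N) (ht : (0 < #|edge t|)%N) :
  [/\ generically_unique_averages [set: oshape R d n t] (oshape_dist dist2),
      generically_unique_averages [set: ushape R d n t] (ushape_dist dist2),
      averages_not_unique [set: oshape R d n t] (oshape_dist dist1)
    & averages_not_unique [set: ushape R d n t] (ushape_dist dist1)] /\
  (forall F : {set {set edge t}}, (exists E, E \in F) -> topology_closed F ->
    [/\ generically_unique_averages (roshape R d n F) (roshape_dist F dist2),
        saturated F ->
        generically_unique_averages (rushape R d n F) (rushape_dist F dist2),
        (exists2 E, E \in F & (1 < #|E|)%N) ->
        averages_not_unique (roshape R d n F) (roshape_dist F dist1)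
      & saturated F -> (exists2 E, E \in F & (1 < #|E|)%N) ->
        averages_not_unique (rushape R d n F) (rushape_dist F dist1)]).
Proof.
have -> : @dist1 R d n t = fun x y => norm1 ((x : {ffun _}) - y).
  by apply/funext => x; apply/funext => y; exact: dist1E.
have -> : @dist2 R d n t = fun x y => norm2 ((x : {ffun _}) - y).
  by apply/funext => x; apply/funext => y; exact: dist2E.
have N1 := @shape_norm1 R d n t; have N2 := @shape_norm2 R d n t.
have two_edges : exists2 E, E \in [set: {set edge t}]%SET & (1 < #|E|)%N.
  by exists [set: edge t]%SET; rewrite ?inE // cardsT card_edge_gt1.
have oT := @oproj_transport R d n t; have uT := @shape_proj_transport R d n t.
split.
  have P1 := piecewise_norm_full N1; have P2 := piecewise_norm_full N2.
  rewrite /ushape_dist /oshape_dist -roshape_setT -rushape_setT -rpreshape_setT.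
  rewrite (quot_dist_shape_proj N1 P1) (quot_dist_shape_proj N2 P2) rushapeE.
  split.
  - exact (quotient_unique_averages hd hn oT P2).
  - exact (quotient_unique_averages hd hn uT P2).
  - exact (quotient_averages_not_unique hd hn oT P1 two_edges).
  - exact (quotient_averages_not_unique hd hn uT P1 two_edges).
move=> F _ _.
have P1 := piecewise_norm_length F N1; have P2 := piecewise_norm_length F N2.
rewrite /rushape_dist /roshape_dist.
rewrite (quot_dist_shape_proj N1 P1) (quot_dist_shape_proj N2 P2) rushapeE.
split=> [|_|E2|_ E2].
- exact (quotient_unique_averages hd hn oT P2).
- exact (quotient_unique_averages hd hn uT P2).
- exact (quotient_averages_not_unique hd hn oT P1 E2).
- exact (quotient_averages_not_unique hd hn uT P1 E2).
Qed.
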